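(* (a) $I(c)/I(c+1)\cong (L/L(c+1))^*$ as $KG$-modules for all $c\ge 0$, where $*$ denotes the dual module. (b) For any $c\ge 0$ the composition factors of the $KG$-module $I(c)/I(c+1)$ are the composition factors of $L(0)/L(1),\dots,L(c)/L(c+1)$ taken together. (c) $I(0)/I(1)\cong L(0)/L(1)$. (d) $I(c)/I(c+1)\cong L^*$ as $KG$-modules for all $c\ge b$, where $b=\nu_\ell([G:B])$.
   Context: Let $n\ge 2$ and $G=\mathrm{GL}_n(q)$, the general linear group over the finite field $F_q$ of characteristic $p$. Let $\ell\ne p$ be a prime, and let $R$ be a local principal ideal domain of characteristic $0$ with maximal ideal $\ell R$, containing a primitive $p$-th root of unity; $K=R/\ell R$. Modules are left modules. $\nu_\ell$ denotes the $\ell$-adic valuation of integers. $B$ is the group of upper triangular matrices in $G$; $S_n$ is viewed as the subgroup of permutation matrices of $G$; $\widehat{S}=\sum_{s\in S}s\in RG$ for $S\subseteq G$. Put $\varepsilon=\sum_{\sigma\in S_n}\mathrm{sg}(\sigma)\,\sigma\widehat{B}\in RG$. The Steinberg lattice is the left ideal $I=RG\cdot\varepsilon$, and $L=I/\ell I$, a $KG$-module. Let $f:I\times I\to R$ be the restriction to $I$ of the $R$-bilinear form on $RG$ given by $(g,h)\mapsto\delta_{g,h}$ for $g,h\in G$, scaled by $1/|B|$ (it takes values in $R$). For $c\ge 0$ put $I(c)=\{x\in I : f(x,I)\subseteq \ell^cR\}$ and $L(c)=(I(c)+\ell I)/\ell I$. Since $\ell I(c)\subseteq I(c+1)$, the quotient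 $I(c)/I(c+1)$ is a $KG$-module. *)

(* Defs.v *)
From HB Require Import structures.
From mathcomp Require Import all_boot all_order all_fingroup all_algebra.
From mathcomp Require Import generic_quotient ring_quotient fraction.
From mathcomp Require Import boolp functions.

Set Implicit Arguments.
Unset Strict Implicit.
Unset Printing Implicit Defensive.
Import GRing.Theory.
Local Open Scope ring_scope.
Local Open Scope quotient_scope.

(* Left modules are [lmodType A] with [A] a possibly noncommutative ring. *)

Section Modules.
Variable A : pzRingType.
Implicit Types M : lmodType A.

Record submodule M := Submodule {
  submod_carrier :> {pred M};
  submod_carrierP : submod_closed submod_carrier
}.

HB.instance Definition _ M (N : submodule M) :=
  GRing.isSubmodClosed.Build A M (submod_carrier N) (submod_carrierP N).

Definition lmod_iso M M' : Prop := exists f : {linear M -> M'}, bijective f.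

Section SubmodOf.
Variables (M : lmodType A) (N : submodule M).

Record submod_of : Type :=
  Submod { submod_val : M; submod_valP : submod_val \in N }.

HB.instance Definition _ := [isSub for submod_val].
HB.instance Definition _ := [Choice of submod_of by <:].
HB.instance Definition _ := [SubChoice_isSubLmodule of submod_of by <:].
End SubmodOf.

Section QuoMod.
Variables (M : lmodType A) (N : submodule M).

Definition quo_mod : Type := Quotient.quot N.
HB.instance Definition _ := GRing.Zmodule.on quo_mod.
HB.instance Definition _ := EqQuotient.on quo_mod.

Definition quo_scale (a : A) : quo_mod -> quo_mod :=
  lift_op1 (Quotient.quot N) ( *:%R a).

Definition quo_pi (x : M) : quo_mod := \pi_(Quotient.quot N) x.

Lemma quo_piE x y : (quo_pi x == quo_pi y) = (x - y \in N).
Proof. by rewrite /quo_pi Quotient.idealrBE. Qed.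

Lemma quo_pi_surj (u : quo_mod) : exists x, quo_pi x = u.
Proof. by exists (repr (u : Quotient.quot N)); rewrite /quo_pi reprK. Qed.

Lemma quo_piB x y : quo_pi (x - y) = quo_pi x - quo_pi y.
Proof. by rewrite /quo_pi raddfB. Qed.

Lemma quo_piD x y : quo_pi (x + y) = quo_pi x + quo_pi y.
Proof. by rewrite /quo_pi raddfD. Qed.

Lemma quo_scaleE a x : quo_scale a (quo_pi x) = quo_pi (a *: x).
Proof.
rewrite /quo_scale; unlock; apply/eqP; rewrite quo_piE -scalerBr rpredZ //.
by rewrite -quo_piE /quo_pi reprK.
Qed.

Lemma quo_scaleA a b u : quo_scale a (quo_scale b u) = quo_scale (a * b) u.
Proof. by have [x <-] := quo_pi_surj u; rewrite !quo_scaleE scalerA. Qed.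

Lemma quo_scale1 : left_id 1 quo_scale.
Proof. by move=> u; have [x <-] := quo_pi_surj u; rewrite quo_scaleE scale1r. Qed.

Lemma quo_scaleDr : right_distributive quo_scale +%R.
Proof.
move=> a u v; have [x <-] := quo_pi_surj u; have [y <-] := quo_pi_surj v.
by rewrite -quo_piD !quo_scaleE -quo_piD scalerDr.
Qed.

Lemma quo_scaleDl u : {morph quo_scale^~ u : a b / a + b}.
Proof.
by move=> a b; have [x <-] := quo_pi_surj u; rewrite !quo_scaleE -quo_piD scalerDl.
Qed.

HB.instance Definition _ := GRing.Zmodule_isLmodule.Build A quo_mod
  quo_scaleA quo_scale1 quo_scaleDr quo_scaleDl.

Lemma quo_pi_is_linear : linear quo_pi.
Proof. by move=> a x y; rewrite quo_piD -quo_scaleE. Qed.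
HB.instance Definition _ := GRing.isLinear.Build A M quo_mod _ quo_pi
  quo_pi_is_linear.

Lemma quo_piZ_eq0 a x : a *: x \in N -> a *: quo_pi x = 0.
Proof.
by move=> aN; rewrite -linearZ; apply/eqP; rewrite -(linear0 quo_pi) quo_piE subr0.
Qed.

End QuoMod.

Section SubIn.
Variables (M : lmodType A) (N N' : submodule M).

Definition sub_in_pred : {pred submod_of N} := [pred x | val x \in N'].

Lemma sub_in_closed : submod_closed sub_in_pred.
Proof.
split=> [|a x y]; rewrite /sub_in_pred !inE ?rpred0 // => xN yN.
by rewrite rpredD ?rpredZ.
Qed.
Definition sub_in := Submodule sub_in_closed.

Definition sum_mod_pred : {pred M} :=
  [pred x | `[< exists2 y, y \in N & exists2 z, z \in N' & x = y + z >]].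

Lemma sum_mod_closed : submod_closed sum_mod_pred.
Proof.
split=> [|a x x']; rewrite /sum_mod_pred !inE.
  by apply/asboolP; exists 0; rewrite ?rpred0 //; exists 0; rewrite ?rpred0 ?addr0.
move=> /asboolP[y yN [z zN ->]] /asboolP[y' yN' [z' zN' ->]].
apply/asboolP; exists (a *: y + y'); first by rewrite rpredD ?rpredZ.
by exists (a *: z + z'); rewrite ?rpredD ?rpredZ // scalerDr addrACA.
Qed.
Definition sum_mod := Submodule sum_mod_closed.
End SubIn.

(* The subquotient [N / N'], intended for [N'] contained in [N]. *)
Definition subquo M (N N' : submodule M) : lmodType A := quo_mod (sub_in N N').

Definition simple_mod M : Prop :=
  (exists x : M, x != 0) /\
  forall N : submodule M, (forall x, x \in N -> x = 0) \/ (forall x, x \in N).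

Definition composition_series M (k : nat) (s : nat -> submodule M) : Prop :=
  [/\ forall x, (x \in s 0%N) = (x == 0),
      forall x, x \in s k,
      forall i, (i < k)%N -> {subset s i <= s i.+1} &
      forall i, (i < k)%N -> simple_mod (subquo (s i.+1) (s i))].

(* [fs] lists the composition factors of [M] with multiplicity, up to
   isomorphism and in any order. *)
Definition composition_factors M (fs : seq (lmodType A)) : Prop :=
  exists (s : nat -> submodule M) (sigma : 'S_(size fs)),
    composition_series (size fs) s /\
    forall i : 'I_(size fs),
      lmod_iso (subquo (s (sigma i).+1) (s (sigma i))) (nth M fs i).

End Modules.

Section GroupAlgebra.
Variables (R : comNzRingType) (gT : finGroupType).

Definition grpalg : Type := {ffun gT -> R}.
HB.instance Definition _ := GRing.Zmodule.on grpalg.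

Implicit Types a b c : grpalg.

Definition ga_one : grpalg := [ffun g => (g == 1%g)%:R].
Definition ga_mul a b : grpalg := [ffun g => \sum_h a h * b (h^-1 * g)%g].
Definition ga_scale (r : R) a : grpalg := [ffun g => r * a g].

Lemma ga_mulA : associative ga_mul.
Proof.
move=> a b c; apply/ffunP=> g; rewrite !ffunE.
under eq_bigr do rewrite ffunE mulr_sumr.
under [RHS]eq_bigr do rewrite ffunE mulr_suml.
rewrite [RHS]exchange_big /=; apply: eq_bigr => h _.
rewrite [RHS](reindex_inj (mulgI h)) /=; apply: eq_bigr => k _.
by rewrite mulrA mulKg invMg mulgA.
Qed.

Lemma ga_mul1 : left_id ga_one ga_mul.
Proof.
move=> a; apply/ffunP=> g; rewrite !ffunE (bigD1 1%g) //= big1 => [|h /negPf h1].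
  by rewrite ffunE eqxx mul1r invg1 mul1g addr0.
by rewrite ffunE h1 mul0r.
Qed.

Lemma ga_mulr1 : right_id ga_one ga_mul.
Proof.
move=> a; apply/ffunP=> g; rewrite !ffunE (bigD1 g) //= big1 => [|h].
  by rewrite ffunE mulVg eqxx mulr1 addr0.
by rewrite ffunE -eq_mulVg1 => /negPf->; rewrite mulr0.
Qed.

Lemma ga_mulDl : left_distributive ga_mul +%R.
Proof.
move=> a b c; apply/ffunP=> g; rewrite !ffunE -big_split /=.
by apply: eq_bigr => h _; rewrite ffunE mulrDl.
Qed.

Lemma ga_mulDr : right_distributive ga_mul +%R.
Proof.
move=> a b c; apply/ffunP=> g; rewrite !ffunE -big_split /=.
by apply: eq_bigr => h _; rewrite ffunE mulrDr.
Qed.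

Lemma ga_one_neq0 : ga_one != 0 :> grpalg.
Proof.
apply/eqP=> /ffunP/(_ 1%g); rewrite !ffunE eqxx => /eqP.
by rewrite (negPf (oner_neq0 R)).
Qed.

HB.instance Definition _ := GRing.Zmodule_isNzRing.Build grpalg
  ga_mulA ga_mul1 ga_mulr1 ga_mulDl ga_mulDr ga_one_neq0.

Lemma ga_scaleA r s a : ga_scale r (ga_scale s a) = ga_scale (r * s) a.
Proof. by apply/ffunP=> g; rewrite !ffunE mulrA. Qed.
Lemma ga_scale1 : left_id 1 ga_scale.
Proof. by move=> a; apply/ffunP=> g; rewrite !ffunE mul1r. Qed.
Lemma ga_scaleDr : right_distributive ga_scale +%R.
Proof. by move=> r a b; apply/ffunP=> g; rewrite !ffunE mulrDr. Qed.
Lemma ga_scaleDl a : {morph ga_scale^~ a : r s / r + s}.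
Proof. by move=> r s; apply/ffunP=> g; rewrite !ffunE mulrDl. Qed.

HB.instance Definition _ := GRing.Zmodule_isLmodule.Build R grpalg
  ga_scaleA ga_scale1 ga_scaleDr ga_scaleDl.

Lemma ga_scaleAl (r : R) (a b : grpalg) : r *: (a * b) = (r *: a) * b.
Proof.
apply/ffunP=> g; rewrite !ffunE mulr_sumr.
by apply: eq_bigr => h _; rewrite ffunE mulrA.
Qed.
HB.instance Definition _ := GRing.Lmodule_isLalgebra.Build R grpalg ga_scaleAl.

Lemma ga_scaleAr (r : R) (a b : grpalg) : r *: (a * b) = a * (r *: b).
Proof.
apply/ffunP=> g; rewrite !ffunE mulr_sumr.
by apply: eq_bigr => h _; rewrite ffunE mulrCA.
Qed.
HB.instance Definition _ := GRing.Lalgebra_isAlgebra.Build R grpalg ga_scaleAr.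

Lemma ga_mulE a b g : (a * b) g = \sum_h a h * b (h^-1 * g)%g.
Proof. by rewrite ffunE. Qed.

Definition ga_elt (g : gT) : grpalg := [ffun h => (h == g)%:R].

Lemma ga_mul_elt a h g : (a * ga_elt h) g = a (g * h^-1)%g.
Proof.
rewrite ga_mulE (bigD1 (g * h^-1)%g) //= big1 => [|k /negPf kg].
  by rewrite !ffunE invMg invgK mulgKV eqxx mulr1 addr0.
rewrite !ffunE; case: eqP => [E|]; last by rewrite mulr0.
by move: kg; rewrite -E invMg invgK mulKVg eqxx.
Qed.

Definition ga_hat (S : {set gT}) : grpalg := \sum_(s in S) ga_elt s.

Lemma ga_eltM g h : ga_elt g * ga_elt h = ga_elt (g * h)%g.
Proof.
apply/ffunP=> k; rewrite ga_mulE (bigD1 g) //= big1 => [|i /negPf ig].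
  by rewrite !ffunE eqxx mul1r addr0 (can2_eq (mulKVg _) (mulKg _)).
by rewrite !ffunE ig mul0r.
Qed.

(* The bilinear form on the group algebra with the group as orthonormal basis. *)
Definition ga_form a b : R := \sum_g a g * b g.

Definition ga_inv a : grpalg := [ffun g => a g^-1%g].

Lemma ga_inv1 : ga_inv 1 = 1.
Proof. by apply/ffunP=> g; rewrite !ffunE eq_invg1. Qed.

Lemma ga_invD a b : ga_inv (a + b) = ga_inv a + ga_inv b.
Proof. by apply/ffunP=> g; rewrite !ffunE. Qed.

Lemma ga_invM a b : ga_inv (a * b) = ga_inv b * ga_inv a.
Proof.
apply/ffunP=> g; rewrite ffunE !ga_mulE (reindex_inj (mulgI g^-1%g)) /=.
apply: eq_bigr => h _.
by rewrite !ffunE !invMg !invgK mulgK mulrC.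
Qed.

Lemma ga_invZ r a : ga_inv (r *: a) = r *: ga_inv a.
Proof. by apply/ffunP=> g; rewrite !ffunE. Qed.

Lemma ga_formM a b c : ga_form (a * b) c = ga_form b (ga_inv a * c).
Proof.
rewrite /ga_form; under eq_bigr do rewrite ga_mulE mulr_suml.
under [RHS]eq_bigr do rewrite ga_mulE mulr_sumr.
rewrite exchange_big /= [RHS]exchange_big /= [RHS](reindex_inj invg_inj) /=.
apply: eq_bigr => h _; rewrite (reindex_inj (mulgI h)) /=.
by apply: eq_bigr => g _; rewrite mulKg ffunE !invgK mulrCA mulrA.
Qed.

Lemma ga_formDl a b c : ga_form (a + b) c = ga_form a c + ga_form b c.
Proof.
by rewrite /ga_form -big_split; apply: eq_bigr => g _; rewrite ffunE mulrDl.
Qed.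

Lemma ga_formZ r a b : ga_form (r%:A * a) b = r * ga_form a b.
Proof.
rewrite -scalerAl mul1r /ga_form mulr_sumr.
by apply: eq_bigr => g _; rewrite ffunE mulrA.
Qed.

Lemma ga_form0l c : ga_form 0 c = 0.
Proof. by rewrite /ga_form big1 // => g _; rewrite ffunE mul0r. Qed.

(* The dual of a module over a group algebra: the linear forms [phi] over the
   coefficient ring, with [(g phi)(x) = phi(g^-1 x)]. *)
Section Dual.
Variable M : lmodType grpalg.

Definition linear_form (phi : M -> R) : Prop :=
  forall (k : R) (x y : M), phi (k%:A *: x + y) = k * phi x + phi y.

Definition linear_form_pred : pred (M -> R) := [pred phi | `[< linear_form phi >]].

Lemma linear_form_closed : zmod_closed linear_form_pred.
Proof.
split=> [|f g]; rewrite /linear_form_pred !inE.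
  by apply/asboolP => k x y; rewrite mulr0 addr0.
move=> /asboolP Hf /asboolP Hg; apply/asboolP => k x y.
by rewrite !fctE Hf Hg mulrBr opprD addrACA.
Qed.
HB.instance Definition _ :=
  GRing.isZmodClosed.Build (M -> R) linear_form_pred linear_form_closed.

Record dual_mod : Type :=
  DualMod { dual_fun : M -> R; dual_funP : dual_fun \in linear_form_pred }.

HB.instance Definition _ := [isSub for dual_fun].
HB.instance Definition _ := [Choice of dual_mod by <:].
HB.instance Definition _ := [SubChoice_isSubZmodule of dual_mod by <:].

Lemma dual_scale_subproof (a : grpalg) (phi : dual_mod) :
  (fun x : M => val phi (ga_inv a *: x)) \in linear_form_pred.
Proof.
case: phi => phi /= /asboolP Hphi; apply/asboolP => k x y.
rewrite -Hphi scalerDr !scalerA; congr (phi (_ *: _ + _)).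
by rewrite -scalerAl mul1r -scalerAr mulr1.
Qed.

Definition dual_scale (a : grpalg) (phi : dual_mod) : dual_mod :=
  DualMod (dual_scale_subproof a phi).

Lemma dual_scaleA a b phi : dual_scale a (dual_scale b phi) = dual_scale (a * b) phi.
Proof.
by apply: val_inj; apply: funext => x /=; rewrite scalerA ga_invM.
Qed.
Lemma dual_scale1 : left_id 1 dual_scale.
Proof.
by move=> phi; apply: val_inj; apply: funext => x /=; rewrite ga_inv1 scale1r.
Qed.
Lemma dual_scaleDr : right_distributive dual_scale +%R.
Proof. by move=> a phi psi; apply: val_inj; apply: funext => x. Qed.
Lemma dual_scaleDl phi : {morph dual_scale^~ phi : a b / a + b}.
Proof.
move=> a b; apply: val_inj; apply: funext => x /=.
case: phi => phi /= /asboolP Hphi; rewrite ga_invD scalerDl !fctE /=.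
by have := Hphi 1 (ga_inv a *: x) (ga_inv b *: x); rewrite !scale1r mul1r.
Qed.
HB.instance Definition _ := GRing.Zmodule_isLmodule.Build grpalg dual_mod
  dual_scaleA dual_scale1 dual_scaleDr dual_scaleDl.
End Dual.

End GroupAlgebra.

(* Reduction: a module [M] over [R G] annihilated by an ideal [m] of [R] is a
   module over [(R/m) G]; a coefficient in [R/m] acts through any lift to [R],
   see [res_scale_lift]. *)
Section Residue.
Variables (R : comNzRingType) (m : idealr R) (gT : finGroupType).
Local Notation RG := (grpalg R gT).
Local Notation K := {ideal_quot m}.
Local Notation KG := (grpalg K gT).

Definition annihilated (M : lmodType RG) : Prop :=
  forall (r : R) (x : M), r \in m -> r%:A *: x = 0.

Definition residue_mod (M : lmodType RG) (hM : annihilated M) : Type := M.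

Section ResidueMod.
Variables (M : lmodType RG) (hM : annihilated M).
HB.instance Definition _ := GRing.Zmodule.on (residue_mod hM).

Definition ga_lift (a : KG) : RG := [ffun g => repr (a g)].
Definition ga_red (a : RG) : KG := [ffun g => \pi_K (a g)].
Definition res_scale (a : KG) (x : residue_mod hM) : residue_mod hM :=
  ga_lift a *: (x : M).

Lemma ga_decomp (a : RG) : a = \sum_g (a g)%:A * ga_elt R g.
Proof.
apply/ffunP=> h; rewrite sum_ffunE (bigD1 h) //= big1 => [|g /negPf gh].
  by rewrite -scalerAl mul1r !ffunE eqxx mulr1 addr0.
by rewrite -scalerAl mul1r !ffunE eq_sym gh mulr0.
Qed.

Lemma annihilated_ga (a : RG) (x : M) : (forall g, a g \in m) -> a *: x = 0.
Proof.
move=> am; rewrite (ga_decomp a) scaler_suml big1 // => g _.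
by rewrite -scalerA hM.
Qed.

Lemma res_scale_lift (a : RG) (x : M) : res_scale (ga_red a) x = a *: x.
Proof.
apply/eqP; rewrite -subr_eq0 -scalerBl; apply/eqP; apply: annihilated_ga => g.
by rewrite !ffunE Quotient.idealrBE reprK.
Qed.

Lemma ga_redK (a : KG) : ga_red (ga_lift a) = a.
Proof. by apply/ffunP=> g; rewrite !ffunE reprK. Qed.

Lemma ga_redD a b : ga_red (a + b) = ga_red a + ga_red b.
Proof. by apply/ffunP=> g; rewrite !ffunE raddfD. Qed.

Lemma ga_redM a b : ga_red (a * b) = ga_red a * ga_red b.
Proof.
apply/ffunP=> g; rewrite !ffunE raddf_sum; apply: eq_bigr => h _.
by rewrite !ffunE; exact: (rmorphM \pi_K).
Qed.

Lemma ga_red1 : ga_red 1 = 1.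
Proof. by apply/ffunP=> g; rewrite !ffunE (rmorph_nat \pi_K). Qed.

Lemma res_scaleA a b u : res_scale a (res_scale b u) = res_scale (a * b) u.
Proof.
by rewrite -[a]ga_redK -[b]ga_redK -ga_redM !res_scale_lift scalerA.
Qed.
Lemma res_scale1 : left_id 1 res_scale.
Proof. by move=> u; rewrite -ga_red1 res_scale_lift scale1r. Qed.
Lemma res_scaleDr : right_distributive res_scale +%R.
Proof. by move=> a u v; rewrite /res_scale scalerDr. Qed.
Lemma res_scaleDl u : {morph res_scale^~ u : a b / a + b}.
Proof.
by move=> a b; rewrite -[a]ga_redK -[b]ga_redK -ga_redD !res_scale_lift scalerDl.
Qed.
HB.instance Definition _ := GRing.Zmodule_isLmodule.Build KG (residue_mod hM)
  res_scaleA res_scale1 res_scaleDr res_scaleDl.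
End ResidueMod.
End Residue.

Section Ideals.
Variable R : comNzRingType.

(* [idealr_closed] describes the proper ideals of [R]. *)
Definition principal_ideal_ring : Prop :=
  forall S : {pred R}, idealr_closed S ->
    exists a : R, forall x, x \in S <-> exists y, x = a * y.

Definition maximal_ideal (S : {pred R}) : Prop :=
  idealr_closed S /\
  forall T : {pred R}, idealr_closed T -> {subset S <= T} -> T =i S.

Definition local_with (m : {pred R}) : Prop :=
  maximal_ideal m /\ forall S : {pred R}, maximal_ideal S -> S =i m.

Definition generated_by (m : {pred R}) (a : R) : Prop :=
  forall x, x \in m <-> exists y, x = a * y.
End Ideals.

Section Steinberg.
Variables (F : finFieldType) (n : nat) (R : idomainType).
Local Notation G := {'GL_n[F]}.
Local Notation RG := (grpalg R G).

(* [is_trig_mx] means lower triangular. *)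
Definition borel : {set G} := [set g : G | is_trig_mx (GLval g)^T].

Lemma borel_group_set : group_set borel.
Proof.
apply/group_setP; split=> [|g h].
  by rewrite inE; apply/is_trig_mxP => i j ij; rewrite !mxE eq_sym -val_eqE ltn_eqF.
rewrite !inE => /is_trig_mxP Hg /is_trig_mxP Hh; apply/is_trig_mxP => i j ij.
rewrite !mxE big1 // => k _; case: (ltnP i k) => [ik|ki].
  by have := Hh i k ik; rewrite mxE => ->; rewrite mulr0.
by have := Hg k j (leq_ltn_trans ki ij); rewrite mxE => ->; rewrite mul0r.
Qed.
Canonical borel_group := Group borel_group_set.

Definition perm_GL (s : 'S_n.-1.+1) : G :=
  FinRing.unit _ (unitmx_perm F s).

Definition steinberg_elt : RG :=
  \sum_(s : 'S_n.-1.+1) (-1) ^+ s *: (ga_elt R (perm_GL s) * ga_hat R borel).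

Definition steinberg_ideal_pred : {pred RG^o} :=
  [pred x | `[< exists a : RG, x = a * steinberg_elt >]].

Lemma steinberg_ideal_closed : submod_closed steinberg_ideal_pred.
Proof.
split=> [|a x y]; rewrite /steinberg_ideal_pred !inE.
  by apply/asboolP; exists 0; rewrite mul0r.
move=> /asboolP[b ->] /asboolP[c ->]; apply/asboolP; exists (a * b + c).
by rewrite mulrDl -mulrA.
Qed.
Definition steinberg_ideal := Submodule steinberg_ideal_closed.

Definition steinberg_lattice : lmodType RG := submod_of steinberg_ideal.
Local Notation I := steinberg_lattice.

Definition lattice_elt (x : I) : RG := submod_val x.

Lemma lattice_eltD (x y : I) : lattice_elt (x + y) = lattice_elt x + lattice_elt y.
Proof. by []. Qed.

Lemma lattice_eltZ (a : RG) (x : I) : lattice_elt (a *: x) = a * lattice_elt x.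
Proof. by []. Qed.

Lemma lattice_elt_borel (x : I) (g b : G) :
  b \in borel -> lattice_elt x (g * b)%g = lattice_elt x g.
Proof.
move=> bB; rewrite /lattice_elt; case: x => x /= /asboolP[a ->].
have E : steinberg_elt * ga_elt R b = steinberg_elt.
  rewrite /steinberg_elt mulr_suml; apply: eq_bigr => s _.
  rewrite -scalerAl -mulrA; congr (_ *: (_ * _)).
  rewrite /ga_hat mulr_suml [RHS](reindex_inj (mulIg b)) /=; apply: eq_big => h.
    by rewrite groupMr.
  by rewrite ga_eltM.
by rewrite -[in LHS]E mulrA ga_mul_elt mulgK.
Qed.

(* Division by |B| takes place in the fraction field of [R]; the values lie in
   [R], see [steinberg_form_int]. *)
Definition steinberg_form (x y : I) : {fraction R} :=
  tofrac (ga_form (lattice_elt x) (lattice_elt y)) / #|borel|%:R.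

Lemma steinberg_formZ (r : R) (x y : I) :
  steinberg_form (r%:A *: x) y = tofrac r * steinberg_form x y.
Proof. by rewrite /steinberg_form lattice_eltZ ga_formZ tofracM mulrA. Qed.

Lemma steinberg_form0 (y : I) : steinberg_form 0 y = 0.
Proof.
by rewrite -(scale0r (0 : I)) -(scale0r (1 : RG)) steinberg_formZ tofrac0 mul0r.
Qed.

Lemma steinberg_formD (x x' y : I) :
  steinberg_form (x + x') y = steinberg_form x y + steinberg_form x' y.
Proof. by rewrite /steinberg_form lattice_eltD ga_formDl tofracD mulrDl. Qed.

Lemma steinberg_formM (a : RG) (x y : I) :
  steinberg_form (a *: x) y = steinberg_form x (ga_inv a *: y).
Proof. by rewrite /steinberg_form !lattice_eltZ ga_formM. Qed.

Lemma steinberg_form_int (x y : I) : exists r : R, steinberg_form x y = tofrac r.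
Proof.
have [B0|B0] := eqVneq (#|borel|%:R : {fraction R}) 0.
  by exists 0; rewrite /steinberg_form B0 invr0 mulr0 tofrac0.
pose rep (g : G) : G := fingroup.repr (g *: borel)%g.
have repP g : exists2 b, b \in borel & rep g = (g * b)%g.
  by have /lcosetP[b] := mem_repr g (lcoset_refl borel_group g); exists b.
have repM g b : b \in borel -> rep (g * b)%g = rep g.
  by move=> bB; rewrite /rep lcosetM lcoset_id.
pose phi g := lattice_elt x g * lattice_elt y g.
exists (\sum_(k | rep k == k) phi k); rewrite /steinberg_form.
suff -> : ga_form (lattice_elt x) (lattice_elt y) =
          (\sum_(k | rep k == k) phi k) * #|borel|%:R.
  by rewrite tofracM -mulrA -[X in _ * X]/(_ / _) tofracMn tofrac1 mulfV ?mulr1.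
rewrite /ga_form (partition_big rep (fun k => rep k == k)) => [|g _]; last first.
  by have [b bB E] := repP g; rewrite {1}E repM.
rewrite mulr_suml; apply: eq_bigr => k /eqP rk.
rewrite -[borel]/(gval borel_group) -(card_lcoset _ k) mulr_natr -sumr_const.
apply: eq_big => [g|g /eqP gk].
  apply/eqP/lcosetP=> [gk|[b bB ->]]; last by rewrite repM.
  have [b bB E] := repP g; exists b^-1%g; first by rewrite groupV.
  by rewrite -gk E mulgK.
have [b bB E] := repP g; rewrite /phi -gk E.
by rewrite !lattice_elt_borel.
Qed.

Variable l : nat.

Definition jantzen_pred (c : nat) : {pred I} :=
  [pred x | `[< forall y : I, exists r : R,
                  steinberg_form x y = tofrac (l%:R ^+ c * r) >]].

Lemma jantzen_closed c : submod_closed (jantzen_pred c).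
Proof.
split=> [|a x x']; rewrite /jantzen_pred !inE.
  by apply/asboolP => y; exists 0; rewrite steinberg_form0 mulr0 tofrac0.
move=> /asboolP Hx /asboolP Hx'; apply/asboolP => y.
have [r Hr] := Hx (ga_inv a *: y); have [r' Hr'] := Hx' y.
exists (r + r'); rewrite mulrDr tofracD -Hr -Hr'.
by rewrite steinberg_formD steinberg_formM.
Qed.
Definition jantzen (c : nat) := Submodule (jantzen_closed c).

Definition l_lattice_pred : {pred I} := [pred x | `[< exists y : I, x = y *+ l >]].

Lemma l_lattice_closed : submod_closed l_lattice_pred.
Proof.
split=> [|a x y]; rewrite /l_lattice_pred !inE.
  by apply/asboolP; exists 0; rewrite mul0rn.
move=> /asboolP[b ->] /asboolP[c ->]; apply/asboolP; exists (a *: b + c).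
by rewrite mulrnDl scalerMnr.
Qed.
Definition l_lattice := Submodule l_lattice_closed.

Variables (m : idealr R) (hm : generated_by m l%:R).
Local Notation K := {ideal_quot m}.
Local Notation KG := (grpalg K G).

Lemma steinberg_mod_subproof : annihilated m (quo_mod l_lattice).
Proof.
move=> r u /hm[s ->]; have [x <-] := quo_pi_surj u.
apply: quo_piZ_eq0; apply/asboolP; exists (s%:A *: x).
by rewrite mulr_natl -!scalerMnl.
Qed.

(* L = I / l I *)
Definition steinberg_mod : lmodType KG := residue_mod steinberg_mod_subproof.
Local Notation L := steinberg_mod.

(* L(c) = (I(c) + l I) / l I *)
Definition jantzen_mod_pred (c : nat) : {pred L} :=
  [pred u | `[< exists2 x, x \in sum_mod (jantzen c) l_lattice &
                           u = quo_pi l_lattice x >]].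

Lemma jantzen_mod_closed c : submod_closed (jantzen_mod_pred c).
Proof.
split=> [|a u v]; rewrite /jantzen_mod_pred !inE.
  by apply/asboolP; exists 0; rewrite ?rpred0 ?linear0.
move=> /asboolP[x Hx ->] /asboolP[y Hy ->]; apply/asboolP.
exists (ga_lift a *: x + y); first by rewrite rpredD ?rpredZ.
by rewrite linearP.
Qed.
Definition jantzen_mod (c : nat) := Submodule (jantzen_mod_closed c).

Lemma jantzen_layer_subproof c :
  annihilated m (subquo (jantzen c) (jantzen c.+1)).
Proof.
move=> r u /hm[s ->]; have [x <-] := quo_pi_surj u.
apply: quo_piZ_eq0; apply/asboolP => y.
have /asboolP/(_ y)[t Ht] := valP x; exists (s * t).
rewrite exprS mulrACA tofracM -Ht.
by rewrite -steinberg_formZ.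
Qed.

(* I(c) / I(c+1) *)
Definition jantzen_layer (c : nat) : lmodType KG :=
  residue_mod (@jantzen_layer_subproof c).

End Steinberg.

(* Main.v *)
Require Import Defs.
From HB Require Import structures.
From mathcomp Require Import all_boot all_order all_fingroup all_algebra.
From mathcomp Require Import generic_quotient ring_quotient fraction.
From mathcomp Require Import boolp functions.

(** Let [E] be the Steinberg element, [U] the group of upper unitriangular
matrices, [w0] the longest permutation.  Everything rests on two facts about the
lattice [I] generated by [E].

  - [I] is free with basis the translates [u E], [u] in [U], and coordinates can
    be read off: up to the sign of [w0], the coefficient of [u E] in [x] is the
    value [x (u w0)] ([bn_coord]).  That the [u E] span is a rank one
    computation: for a simple reflection [s] and a nontrivial element [x(a)] of
    its root group, [s x(a) E = x(1/a) E - E] ([bn_rank1_rel]), and the Borel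
    subgroup and the simple reflections generate the whole group ([weyl_gen]).

  - Let [y] be the sum of the translates [u E].  For [x] in [I] and every group
    element [g], the value at [x] and [g y] of the form is [[G : B] x(g)]
    ([bn_form_dual], [stform_dual]).  The proportionality is immediate, since
    [x] is a combination of the [u E] and [y] is invariant under [U]; the
    constant comes from computing in two ways the trace of the operator that
    sends a group element [h] to [h y] ([bn_trace]).

Consequently, if [x] lies in [I(c+1)] and [c] is at least the valuation of
[[G : B]], all values of [x] are divisible by [l], hence so are its coordinates,
and [x] lies in [l I] ([jantzen_sub_l_lattice]): thus [L(c+1) = 0].

Part (a) is a duality statement about a symmetric bilinear form on a free module
over a discrete valuation ring.  The element [x] of [I(c)] defines the
functional sending [y] to the class of [l^-c f(x, y)] modulo [l]; it kills
[I(c+1)] and [l I], so it lives on [L / L(c+1)], and it vanishes exactly when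
[x] is in [I(c+1)].  Every functional on [L / L(c+1)] arises in this way: this
is a congruence to be solved for the Gram matrix, which becomes trivial once the
matrix has been made diagonal ([diagonalize], [dual_image]).  Part (d) is (a)
together with [L(c+1) = 0].

Parts (b) and (c) only use that [l x] is in [I(c+1)] exactly when [x] is in
[I(c)].  The inclusion of [I(c)] in [I] induces a surjection from [I(c)/I(c+1)]
to [L(c)/L(c+1)] whose kernel is the image of [I(c-1)/I(c)] under multiplication
by [l] (and is zero for [c = 0]), so the composition factors accumulate by
induction ([composition_factors_layerS]).  The quotients [L(i)/L(i+1)] do have
composition series because [L] is spanned by finitely many vectors over the
residue field ([finite_length_flag]). *)

Set Implicit Arguments.
Unset Strict Implicit.
Unset Printing Implicit Defensive.
Import GRing.Theory.
Local Open Scope ring_scope.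

(** * Group algebra elements *)

Section GA.
Variables (R : comNzRingType) (gT : finGroupType).
Local Notation RG := (grpalg R gT).
Local Notation el := (@ga_elt R gT).
Implicit Types (a b : RG) (A : {group gT}).

Lemma ga_elt_mul g a h : (el g * a) h = a (g^-1 * h)%g.
Proof.
rewrite ga_mulE (bigD1 g) //= big1 => [|k /negPf kg].
  by rewrite ffunE eqxx mul1r addr0.
by rewrite ffunE kg mul0r.
Qed.

Lemma ga_hat_elt A g : g \in A -> el g * ga_hat R A = ga_hat R A.
Proof.
move=> gA; rewrite /ga_hat mulr_sumr [RHS](reindex_inj (mulgI g)) /=.
by apply: eq_big => h; rewrite ?groupMl // ga_eltM.
Qed.

Lemma ga_hatE (A : {set gT}) g : ga_hat R A g = (g \in A)%:R.
Proof.
rewrite /ga_hat sum_ffunE; case: (boolP (g \in A)) => gA.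
  rewrite (bigD1 g) //= big1 => [|h /andP[_ /negPf hg]].
    by rewrite ffunE eqxx addr0.
  by rewrite ffunE eq_sym hg.
by rewrite big1 // => h hA; rewrite ffunE; case: eqP => // E; rewrite E hA in gA.
Qed.

Lemma scale_algA (M : lmodType RG) (k k' : R) (x : M) :
  k%:A *: (k'%:A *: x) = (k * k')%:A *: x.
Proof. by rewrite scalerA -scalerAl mul1r scalerA. Qed.

Lemma ga_formC a b : ga_form a b = ga_form b a.
Proof. by apply: eq_bigr => g _; rewrite mulrC. Qed.

Lemma ga_formZl r a b : ga_form (r *: a) b = r * ga_form a b.
Proof. by rewrite -ga_formZ -scalerAl mul1r. Qed.

Lemma ga_form_suml (I : Type) (s : seq I) (Q : pred I) (f : I -> RG) b :
  ga_form (\sum_(i <- s | Q i) f i) b = \sum_(i <- s | Q i) ga_form (f i) b.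
Proof.
elim/big_rec2: _ => [|i x z _ <-]; first exact: ga_form0l.
by rewrite ga_formDl.
Qed.

Lemma ga_inv_elt g : ga_inv (el g) = el g^-1%g.
Proof. by apply/ffunP=> h; rewrite !ffunE (can2_eq invgK invgK). Qed.

Lemma ga_inv_hat A : ga_inv (ga_hat R A) = ga_hat R A.
Proof. by apply/ffunP=> g; rewrite ffunE !ga_hatE groupV. Qed.

Lemma ga_inv_sum (I : Type) (s : seq I) (Q : pred I) (f : I -> RG) :
  ga_inv (\sum_(i <- s | Q i) f i) = \sum_(i <- s | Q i) ga_inv (f i).
Proof.
elim/big_rec2: _ => [|i x z _ <-]; first by apply/ffunP=> g; rewrite !ffunE.
by rewrite ga_invD.
Qed.

Lemma ga_form_eltl g a b : ga_form (el g * a) b = ga_form a (el g^-1%g * b).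
Proof. by rewrite ga_formM ga_inv_elt. Qed.

End GA.

(** * Steinberg element of a split BN-pair with symmetric Weyl group *)

(** Equivalently, [b] fixes every cell [t B] with [t i < t j].  In the general
linear group this is so for the diagonal matrices and for the root group at
[(i, j)]. *)
Definition fixes_cells (gT : finGroupType) (m : nat) (B : {set gT})
    (w : 'S_m -> gT) (i j : 'I_m) (b : gT) : Prop :=
  forall t : 'S_m, (t i < t j)%N -> ((w t)^-1 * b * w t)%g \in B.

(** What the study of the Steinberg element uses of a finite group with a
split BN-pair whose Weyl group is a symmetric group: a Borel subgroup [B = U T],
representatives [w] of the Weyl group that form a subgroup, disjointness of the
Bruhat cells, and generation by [B] and the simple reflections.  The field
[bn_opp] says that [U] meets the conjugate of [B] by [bn_long] trivially, which
makes [bn_long] play the role of the longest element.  The field [bn_rank1]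
carries the rank one relations: [u1] is the component of [u] in the unipotent
radical of the minimal parabolic subgroup and [x] the component in the root
group; the last condition is the identity that rewrites a product [s x s], which
lies in the opposite root group, as [y s b] with [b] in the Borel subgroup of
the rank one subgroup. *)
Record bn_data (gT : finGroupType) (m : nat) := BNData {
  bnB : {group gT};
  bnU : {group gT};
  bnT : {group gT};
  bnw : 'S_m -> gT;
  bn_long : 'S_m;
  bnwM : forall s t, bnw (s * t)%g = (bnw s * bnw t)%g;
  bnUB : bnU \subset bnB;
  bnTB : bnT \subset bnB;
  bnUT : forall b, b \in bnB -> exists2 h, h \in bnT & (b * h)%g \in bnU;
  bn_disj : forall g, g \in bnU -> g \in bnT -> g = 1%g;
  bn_norm : forall h s, h \in bnT -> ((bnw s)^-1 * h * bnw s)%g \in bnB;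
  bn_bruhat : forall s t b, b \in bnB -> ((bnw s)^-1 * b * bnw t)%g \in bnB -> s = t;
  bn_opp : forall u, u \in bnU -> ((bnw bn_long)^-1 * u * bnw bn_long)%g \in bnB -> u = 1%g;
  bn_rank1 : forall (i j : 'I_m) (u : gT), j = i.+1 :> nat -> u \in bnU ->
    let s := bnw (tperm i j) in
    let Q := fixes_cells bnB bnw i j in
    (s * u * s)%g \in bnU \/
    exists u1 x y, [/\ u = (u1 * x)%g, (s * u1 * s)%g \in bnU, y \in bnU &
      [/\ Q x, Q y & Q (s * y^-1 * s * x * s)%g]];
  bn_gen : forall X : gT -> Prop, (forall g h, X g -> X h -> X (g * h)%g) ->
    (forall b, b \in bnB -> X b) ->
    (forall i j : 'I_m, j = i.+1 :> nat -> X (bnw (tperm i j))) ->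
    forall g, X g
}.

Section BN.
Variables (R : comNzRingType) (gT : finGroupType) (m : nat) (D : bn_data gT m).
Local Notation RG := (grpalg R gT).
Local Notation el := (@ga_elt R gT).
Local Notation B := (bnB D).
Local Notation U := (bnU D).
Local Notation T := (bnT D).
Local Notation w := (bnw D).
Local Notation w0 := (bn_long D).

Definition bn_elt : RG := \sum_(s : 'S_m) (-1) ^+ s *: (el (w s) * ga_hat R B).
Local Notation E := bn_elt.

Lemma bnw1 : w 1%g = 1%g.
Proof. by apply: (mulgI (w 1%g)); rewrite -bnwM !mulg1. Qed.

Lemma bnwV s : w s^-1%g = (w s)^-1%g.
Proof. by apply: (mulgI (w s)); rewrite -bnwM !mulgV bnw1. Qed.

Lemma bn_eltE g : E g = \sum_(s : 'S_m) (-1) ^+ s * (((w s)^-1 * g)%g \in B)%:R.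
Proof.
by rewrite sum_ffunE; apply: eq_bigr => s _; rewrite ffunE ga_elt_mul ga_hatE.
Qed.

(** Bruhat cells are disjoint, so only the summand of [s] in the Steinberg
element can be nonzero at a point of the cell of [s]. *)
Lemma bn_elt_cell b s : b \in B -> E (b * w s)%g = (-1) ^+ s * (((w s)^-1 * b * w s)%g \in B)%:R.
Proof.
move=> bB; rewrite bn_eltE (bigD1 s) //= big1 ?addr0 ?mulgA // => t ts.
case: (boolP (_ \in B)) => [tB|_]; last by rewrite mulr0.
by rewrite mulgA in tB; rewrite (bn_bruhat bB tB) eqxx in ts.
Qed.

Lemma bn_elt_borel b : b \in B -> E b = 1.
Proof.
move=> bB; rewrite -[b in LHS]mulg1 -bnw1 bn_elt_cell // odd_perm1 expr0 mul1r.
by rewrite bnw1 invg1 mul1g mulg1 bB.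
Qed.

(** On the big cell [U w0 B] the translates of the Steinberg element by [U] have
disjoint supports.  This gives their independence and the coordinates. *)
Lemma bn_elt_big_cell u v : u \in U -> v \in U ->
  (el u * E) (v * w w0)%g = (-1) ^+ w0 * (u == v)%:R.
Proof.
move=> uU vU; have uvU : (u^-1 * v)%g \in U by rewrite groupM ?groupV.
rewrite ga_elt_mul mulgA bn_elt_cell; last exact: (subsetP (bnUB D)).
congr (_ * (nat_of_bool _)%:R); apply/idP/eqP => [H|->]; last by rewrite mulVg mulg1 mulVg group1.
by apply/eqP; rewrite eq_mulVg1 (bn_opp uvU H).
Qed.

Lemma bn_cell_fix s b : ((w s)^-1 * b * w s)%g \in B ->
  el b * (el (w s) * ga_hat R B) = el (w s) * ga_hat R B.
Proof.
move=> bB; rewrite mulrA ga_eltM.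
have -> : (b * w s = w s * ((w s)^-1 * b * w s))%g by rewrite !mulgA mulgV mul1g.
by rewrite -ga_eltM -mulrA ga_hat_elt.
Qed.

Lemma bn_elt_torus h : h \in T -> el h * E = E.
Proof.
move=> hT; rewrite /bn_elt mulr_sumr; apply: eq_bigr => s _.
by rewrite -scalerAr bn_cell_fix ?bn_norm.
Qed.

Lemma bn_elt_perm s : el (w s) * E = (-1) ^+ s *: E.
Proof.
rewrite /bn_elt mulr_sumr [in RHS](reindex_inj (mulgI s)) /= scaler_sumr.
apply: eq_bigr => t _.
by rewrite -scalerAr mulrA ga_eltM -bnwM scalerA odd_permM signr_addb signrMK.
Qed.

Section RankOne.
Variables (i j : 'I_m).
Hypothesis ij : i != j.
Local Notation s := (w (tperm i j)).
Let E2 : RG := \sum_(t : 'S_m | (t i < t j)%N) (-1) ^+ t *: (el (w t) * ga_hat R B).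

Lemma bn_rank1_fix b : fixes_cells B w i j b -> el b * E2 = E2.
Proof.
move=> bQ; rewrite /E2 mulr_sumr; apply: eq_bigr => t /bQ tB.
by rewrite -scalerAr bn_cell_fix.
Qed.

(** The permutations come in pairs [t], [s t], exchanged by the simple reflection
[s]; [E2] collects the member of each pair with [t i < t j], and the sign makes
the other half its negative translate. *)
Lemma bn_rank1_split : E = E2 - el s * E2.
Proof.
rewrite {1}/E (bigID (fun t : 'S_m => (t i < t j)%N)) /=; congr (_ + _).
rewrite /E2 mulr_sumr -sumrN (reindex_inj (mulgI (tperm i j))) /=.
apply: eq_big => [t|t _].
  rewrite !permM tpermL tpermR -leqNgt leq_eqVlt; case: eqP => //= /val_inj/perm_inj ji.
  by move: ij; rewrite ji eqxx.
by rewrite bnwM -ga_eltM odd_permM odd_tperm ij signr_addb mulN1r scaleNr -scalerAr mulrA.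
Qed.

(** Writing [E = E2 - s E2], all factors that fix the cells of [E2] disappear:
[s x E = s E2 - s x s E2] and [s x s E2 = y s E2], while
[y E - E = s E2 - y s E2]. *)
Lemma bn_rank1_rel x y :
  fixes_cells B w i j x -> fixes_cells B w i j y ->
  fixes_cells B w i j (s * y^-1 * s * x * s)%g ->
  el (s * x)%g * E = el y * E - E.
Proof.
move=> /bn_rank1_fix xE /bn_rank1_fix yE /bn_rank1_fix bE.
have sK : (s * s = 1)%g by rewrite -bnwM tperm2 bnw1.
have sxs : el (s * x * s)%g * E2 = el y * (el s * E2).
  rewrite -{2}bE !mulrA !ga_eltM !mulgA; congr (el _ * _).
  by rewrite -(mulgA y) sK mulg1 mulgV mul1g.
have sxE : el (s * x)%g * E2 = el s * E2 by rewrite -ga_eltM -mulrA xE.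
rewrite bn_rank1_split !mulrBr yE sxE mulrA ga_eltM sxs.
by rewrite opprB [RHS]addrC addrA subrK.
Qed.
End RankOne.

Definition bn_span (x : RG) : Prop :=
  exists c : gT -> R, x = \sum_(u in U) c u *: (el u * E).

Lemma bn_span_elt u : u \in U -> bn_span (el u * E).
Proof.
move=> uU; exists (fun v => (v == u)%:R); rewrite (bigD1 u) //= eqxx scale1r.
by rewrite big1 ?addr0 // => v /andP[_ /negPf ->]; rewrite scale0r.
Qed.

Lemma bn_spanD x y : bn_span x -> bn_span y -> bn_span (x + y).
Proof.
move=> [c ->] [d ->]; exists (fun u => c u + d u); rewrite -big_split.
by apply: eq_bigr => u _; rewrite scalerDl.
Qed.

Lemma bn_spanZ k x : bn_span x -> bn_span (k *: x).
Proof.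
move=> [c ->]; exists (fun u => k * c u); rewrite scaler_sumr.
by apply: eq_bigr => u _; rewrite scalerA.
Qed.

Lemma bn_span_sum (I : Type) (r : seq I) (Q : pred I) (f : I -> RG) :
  (forall i, Q i -> bn_span (f i)) -> bn_span (\sum_(i <- r | Q i) f i).
Proof.
move=> H; elim/big_ind: _ => //; last exact: bn_spanD.
by exists (fun=> 0); rewrite big1 // => u _; rewrite scale0r.
Qed.

(** The set of [g] for which all translates of the spanning vectors remain in the
span is closed under products; it contains [B], because [T] fixes [E], and the
simple reflections by the rank one relation. *)
Lemma bn_span_translate g u : u \in U -> bn_span (el (g * u)%g * E).
Proof.
move: u; pose X h := forall u, u \in U -> bn_span (el (h * u)%g * E).
suff: X g by []; apply: (@bn_gen _ _ D X) => {g} [g h Hg Hh u uU|b bB u uU|i j ij u uU].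
- rewrite -mulgA -ga_eltM -mulrA; have [c ->] := Hh u uU; rewrite mulr_sumr.
  apply: bn_span_sum => v vU; rewrite -scalerAr mulrA ga_eltM.
  exact/bn_spanZ/Hg.
- have buB : (b * u)%g \in B by rewrite groupM // (subsetP (bnUB D)).
  have [h hT buh] := bnUT buB.
  by rewrite -(bn_elt_torus hT) mulrA ga_eltM; apply: bn_span_elt.
have nij : i != j by apply/eqP => E1; move: ij; rewrite E1 => /n_Sn.
have sE : el (w (tperm i j)) * E = - E.
  by rewrite bn_elt_perm odd_tperm nij expr1 scaleN1r.
have sK : (w (tperm i j) * w (tperm i j) = 1)%g by rewrite -bnwM tperm2 bnw1.
have [susU|[u1 [x [y [uE su1sU yU [xQ yQ bQ]]]]]] := bn_rank1 ij uU.
  have -> : (w (tperm i j) * u = w (tperm i j) * u * w (tperm i j) * w (tperm i j))%g.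
    by rewrite -[RHS]mulgA sK mulg1.
  rewrite -ga_eltM -mulrA sE mulrN -scaleN1r.
  exact/bn_spanZ/bn_span_elt.
have -> : (w (tperm i j) * u)%g =
    (w (tperm i j) * u1 * w (tperm i j) * (w (tperm i j) * x))%g.
  by rewrite uE mulgA -[in RHS]mulgA (mulgA (w (tperm i j))) sK mul1g -!mulgA.
rewrite -ga_eltM -mulrA (bn_rank1_rel nij xQ yQ bQ) mulrBr mulrA ga_eltM -scaleN1r.
apply: bn_spanD; last exact/bn_spanZ/bn_span_elt.
by apply: bn_span_elt; rewrite groupM.
Qed.

Lemma bn_span_ideal (a : RG) : bn_span (a * E).
Proof.
rewrite (ga_decomp a) mulr_suml; apply: bn_span_sum => g _.
rewrite -scalerAl mul1r -scalerAl -[g in el g]mulg1; apply: bn_spanZ.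
by apply: bn_span_translate; rewrite group1.
Qed.

Lemma bn_coord (a : RG) (x := a * E) :
  x = \sum_(u in U) ((-1) ^+ w0 * x (u * w w0)%g) *: (el u * E).
Proof.
have [c xE] := bn_span_ideal a; rewrite {1}/x xE; apply: eq_bigr => u uU.
congr (_ *: _); rewrite /x xE sum_ffunE (bigD1 u) //= big1 => [|v /andP[vU vu]].
  by rewrite ffunE bn_elt_big_cell // eqxx mulr1 addr0 mulrCA -expr2 sqrr_sign mulr1.
by rewrite ffunE bn_elt_big_cell // (negPf vu) mulr0 mulr0.
Qed.

(** Pairing with this vector extracts the value at [1], see [bn_form_dual]. *)
Definition bn_dual : RG := ga_hat R U * E.
Local Notation y := bn_dual.

Lemma bn_unip_dual u : u \in U -> el u * y = y.
Proof. by move=> uU; rewrite mulrA ga_hat_elt. Qed.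

Lemma bn_elt_unip u : u \in U -> (el u * E) 1%g = 1.
Proof.
by move=> uU; rewrite ga_elt_mul mulg1 bn_elt_borel // groupV (subsetP (bnUB D)).
Qed.

Lemma bn_dual1 : y 1%g = #|U|%:R.
Proof.
rewrite /y /ga_hat mulr_suml sum_ffunE -sumr_const.
by apply: eq_bigr => u uU; rewrite bn_elt_unip.
Qed.

(** Both sides are linear in [a E], and on a spanning vector [u E] with [u] in [U]
the left side is independent of [u], because [y] is invariant under [U], while
the value at [1] is always [1]. *)
Lemma bn_form_dual1 a : ga_form (a * E) y = ga_form E y * (a * E) 1%g.
Proof.
have [c ->] := bn_span_ideal a; rewrite ga_form_suml sum_ffunE mulr_sumr.
apply: eq_bigr => u uU; rewrite ffunE bn_elt_unip // ga_formZl ga_form_eltl.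
by rewrite bn_unip_dual ?groupV // mulr1 mulrC.
Qed.

Lemma bn_form_dual_eq a g : ga_form (a * E) (el g * y) = ga_form E y * (a * E) g.
Proof.
rewrite ga_formC ga_form_eltl ga_formC mulrA bn_form_dual1 -mulrA ga_elt_mul.
by rewrite invgK mulg1.
Qed.

Lemma bn_hat_borel : ga_hat R B = ga_hat R U * ga_hat R T.
Proof.
apply/ffunP=> g; rewrite ga_hatE /ga_hat mulr_sumr sum_ffunE.
under eq_bigr do rewrite ga_mul_elt -/(ga_hat R U) ga_hatE.
case: (boolP (g \in B)) => gB; last first.
  rewrite big1 // => h hT; case: (boolP (_ \in U)) => // ghU.
  case/negP: gB; rewrite -[g](mulgKV h) groupM //.
    exact: (subsetP (bnUB D)).
  exact: (subsetP (bnTB D)).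
have [h hT ghU] := bnUT gB; rewrite (bigD1 h^-1%g) ?groupV //= invgK ghU.
rewrite big1 ?addr0 // => k /andP[kT kh]; case: (boolP (_ \in U)) => // gkU.
have kh1 : (k * h = 1)%g.
  apply: (@bn_disj _ _ D); last by rewrite groupM.
  have -> : (k * h = (g * k^-1)^-1 * (g * h))%g by rewrite invMg invgK -mulgA mulKg.
  by rewrite groupM ?groupV.
by case/eqP: kh; apply: (mulIg h); rewrite kh1 mulVg.
Qed.

Hypothesis T0 : GRing.lreg (#|T|%:R : R).

(** Up to the factor [|T|], the dual vector is the sum with signs of the
[hat B s hat B], and inversion permutes these terms. *)
Lemma bn_dual_sym g : y g^-1%g = y g.
Proof.
suff H : ga_inv (ga_hat R B * E) = ga_hat R B * E.
  have hBE : ga_hat R B * E = #|T|%:R *: y.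
    rewrite bn_hat_borel -mulrA scalerAr; congr (_ * _).
    rewrite /ga_hat mulr_suml scaler_nat -sumr_const.
    by apply: eq_bigr => h hT; rewrite bn_elt_torus.
  apply: T0; move/ffunP/(_ g): H.
  by rewrite hBE ffunE !ffunE.
rewrite /bn_elt mulr_sumr ga_inv_sum [RHS](reindex_inj invg_inj) /=.
apply: eq_bigr => s _.
rewrite -!scalerAr ga_invZ odd_permV !ga_invM ga_inv_elt !ga_inv_hat.
by rewrite bnwV mulrA.
Qed.

Lemma bn_dual_elt_sym g h : (el g * y) h = (el h * y) g.
Proof. by rewrite !ga_elt_mul -bn_dual_sym invMg invgK. Qed.

(** Both sides are the trace of the operator [h |-> h y] on the group algebra.
The diagonal coefficients all equal [y(1) = |U|].  On the other hand, expanding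
[h y] in the basis of the [u E] and using the symmetry of [y], each basis vector
contributes the pairing of [u E] with [u w0 y], which is the proportionality
constant times the coefficient [(u E)(u w0)], a sign that cancels against the
one in the coordinates. *)
Lemma bn_trace : ga_form E y * #|U|%:R = #|gT|%:R * #|U|%:R.
Proof.
transitivity (\sum_h (el h * y) h); last first.
  under eq_bigr do rewrite ga_elt_mul mulVg bn_dual1.
  by rewrite sumr_const mulr_natl.
under [RHS]eq_bigr => h _.
  rewrite /bn_dual mulrA bn_coord -mulrA -/y sum_ffunE.
  under eq_bigr do rewrite ffunE bn_dual_elt_sym -mulrA.
  over.
rewrite exchange_big /= mulr_natr -sumr_const; apply: eq_bigr => u uU.
rewrite -mulr_sumr.
have -> : \sum_h (el (u * w w0)%g * y) h * (el u * E) h =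
          ga_form E y * (-1) ^+ w0.
  by rewrite -/(ga_form _ _) ga_formC bn_form_dual_eq bn_elt_big_cell // eqxx mulr1.
by rewrite mulrCA -expr2 sqrr_sign mulr1.
Qed.

Lemma bn_form_dual a g : GRing.rreg (#|U|%:R : R) ->
  ga_form (a * E) (el g * y) = #|gT|%:R * (a * E) g.
Proof. by move=> U0; rewrite bn_form_dual_eq (U0 _ _ bn_trace). Qed.
End BN.

(** * The BN-pair of the general linear group *)

Section Borel.
Variables (F : finFieldType) (n : nat).
Local Notation G := (matrix_GLtype__canonical__fingroup_FinGroup n F).
Local Notation B := (borel F n).
Local Notation N := n.-1.+1.
Definition weyl (s : 'S_N) : G := perm_GL F s.
Local Notation P := weyl.

Lemma borelP (g : G) :
  reflect (forall i j : 'I_N, (j < i)%N -> GLval g i j = 0) (g \in B).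
Proof.
rewrite inE; apply: (iffP is_trig_mxP) => H i j ij; first by have := H j i ij; rewrite mxE.
by rewrite mxE H.
Qed.

Lemma GL_inj (g h : G) : (forall i j, GLval g i j = GLval h i j) -> g = h.
Proof. by move=> E; apply/val_inj/matrixP. Qed.

Lemma borelM (g h : G) : g \in B -> h \in B -> (g * h)%g \in B.
Proof. exact: (@groupM _ (borel_group F n) g h). Qed.

Lemma borelV (g : G) : g \in B -> g^-1%g \in B.
Proof. by move=> gB; rewrite (@groupVr _ (borel_group F n) g gB). Qed.

Lemma weylM s t : P (s * t)%g = (P s * P t)%g.
Proof. by apply: val_inj; rewrite /= perm_mxM. Qed.

Lemma weyl1 : P 1%g = 1%g.
Proof. by apply: val_inj; rewrite /= perm_mx1. Qed.

Lemma weylV s : P s^-1%g = (P s)^-1%g.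
Proof. by apply: (mulgI (P s)); rewrite -weylM !mulgV weyl1. Qed.

Lemma GLvalM (g h : G) : GLval (g * h)%g = GLval g *m GLval h.
Proof. by []. Qed.

Lemma weyl_mulE s (g : G) i j : GLval (P s * g)%g i j = GLval g (s i) j.
Proof. by rewrite GLvalM -row_permE mxE. Qed.

Lemma weyl_mulEr s (g : G) i j : GLval (g * P s)%g i j = GLval g i ((s^-1)%g j).
Proof.
have E : GLval (P s) = perm_mx s^-1^-1 by rewrite invgK.
by rewrite GLvalM E -col_permE mxE.
Qed.

Lemma GLval1 i j : GLval (1%g : G) i j = (i == j)%:R.
Proof. by rewrite /= mxE. Qed.

(** Conjugating by a permutation matrix permutes the positions of the entries. *)
Lemma weyl_borel (s : 'S_N) (g : G) :
  reflect (forall i j, (s j < s i)%N -> GLval g i j = 0)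
          (((P s)^-1 * g * P s)%g \in B).
Proof.
apply: (iffP (borelP _)) => H i j ij; last first.
  by rewrite weyl_mulEr -weylV weyl_mulE H // !permKV.
by have := H (s i) (s j) ij; rewrite weyl_mulEr -weylV weyl_mulE !permK.
Qed.

Lemma GLval_diag_neq0 (b : G) i : b \in B -> GLval b i i != 0.
Proof.
rewrite inE => /det_trig; rewrite det_tr => E.
have : \det (GLval b) != 0 by rewrite -unitfE -unitmxE; exact: valP b.
by rewrite E => /prodf_neq0/(_ i isT); rewrite mxE.
Qed.

(** A permutation of the integers below [m] has a fixed sum of values. *)
Lemma perm_le_eq m (s t : 'S_m) : (forall i, s i <= t i)%N -> s = t.
Proof.
move=> st; apply/permP => i; apply/val_inj/eqP.
have sumE (r : 'S_m) : (\sum_i r i = \sum_(i < m) i)%N.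
  by rewrite [RHS](reindex_inj (@perm_inj _ r)).
have /leqif_sum[_] : forall i : 'I_m, true -> (s i <= t i ?= iff (s i == t i :> nat))%N.
  by move=> j _; split=> //.
by rewrite !sumE eqxx => /esym/forallP/(_ i).
Qed.

(** The diagonal entries of [b] are nonzero; after moving rows and columns, the
one in position [i] sits at [(s i, t i)], which must not be below the diagonal.
This is the disjointness of the Bruhat cells. *)
Lemma borel_perm_eq s t (b : G) :
  b \in B -> ((P s)^-1 * b * P t)%g \in B -> s = t.
Proof.
move=> bB /borelP H; apply: perm_le_eq => i; rewrite leqNgt; apply/negP => lt.
have := GLval_diag_neq0 i bB; have := H (s i) (t i) lt.
by rewrite weyl_mulEr -weylV weyl_mulE !permK => ->; rewrite eqxx.
Qed.

Definition unip : {set G} := [set g in B | [forall i, GLval g i i == 1]].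
Definition torus : {set G} := [set g : G | is_diag_mx (GLval g)].

Lemma unipP (g : G) :
  reflect ((forall i j : 'I_N, (j < i)%N -> GLval g i j = 0) /\ forall i, GLval g i i = 1)
          (g \in unip).
Proof.
rewrite inE; apply: (iffP andP) => [[/borelP H /forallP K]|[H K]].
  by split=> // i; apply/eqP.
by split; [apply/borelP | apply/forallP => i; rewrite K].
Qed.

Lemma torusP (g : G) :
  reflect (forall i j, i != j -> GLval g i j = 0) (g \in torus).
Proof. by rewrite inE; exact: is_diag_mxP. Qed.

Lemma borel_diagM (g h : G) i : g \in B -> h \in B ->
  GLval (g * h)%g i i = GLval g i i * GLval h i i.
Proof.
move=> /borelP Hg /borelP Hh; rewrite GLvalM mxE (bigD1 i) //= big1 ?addr0 // => k ki.
case: (ltngtP i k) => [ik|ki'|/val_inj E]; last by rewrite E eqxx in ki.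
  by rewrite [X in _ * X]Hh ?mulr0.
by rewrite Hg ?mul0r.
Qed.

Lemma unip_sub_borel : unip \subset B.
Proof. by apply/subsetP => g; rewrite inE => /andP[]. Qed.

Lemma torus_sub_borel : torus \subset B.
Proof. by apply/subsetP => g /torusP H; apply/borelP => i j ji; rewrite H // neq_ltn ji orbT. Qed.

Lemma unip_group_set : group_set unip.
Proof.
apply/group_setP; split=> [|g h gU hU].
  by apply/unipP; split=> [i j ji|i]; rewrite GLval1 ?eqxx // -val_eqE gtn_eqF.
have gB := subsetP unip_sub_borel _ gU; have hB := subsetP unip_sub_borel _ hU.
apply/unipP; split=> [|i]; first by apply/borelP; apply: borelM.
by rewrite borel_diagM //; move: gU hU => /unipP[_ ->] /unipP[_ ->]; rewrite mulr1.
Qed.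
Canonical unip_group := Group unip_group_set.

Lemma torus_mulE (h g : G) i j : h \in torus ->
  GLval (h * g)%g i j = GLval h i i * GLval g i j.
Proof.
move=> /torusP H; rewrite GLvalM mxE (bigD1 i) //= big1 ?addr0 // => k ki.
by rewrite H ?mul0r // eq_sym.
Qed.

Lemma torus_group_set : group_set torus.
Proof.
apply/group_setP; split=> [|g h gU hU].
  by apply/torusP => i j ij; rewrite GLval1 (negPf ij).
by apply/torusP => i j ij; rewrite torus_mulE //; move/torusP: hU => ->; rewrite ?mulr0.
Qed.
Canonical torus_group := Group torus_group_set.

Lemma torusV (h : G) : h \in torus -> h^-1%g \in torus.
Proof. by move=> hH; rewrite (@groupVr _ torus_group h hH). Qed.

Lemma torus_exists (b : G) : b \in B ->
  exists2 h, h \in torus & forall i, GLval h i i = GLval b i i.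
Proof.
move=> bB; pose d : 'rV[F]_N := \row_i GLval b i i.
have Hu : diag_mx d \is a GRing.unit.
  rewrite unitmxE det_diag unitfE; apply/prodf_neq0 => i _.
  by rewrite mxE GLval_diag_neq0.
exists (FinRing.unit _ Hu : G); first by rewrite inE /=; apply: diag_mx_is_diag.
by move=> i; rewrite /= !mxE eqxx.
Qed.

Lemma borel_torus_coset (b : G) : b \in B -> exists2 h, h \in torus & (b * h)%g \in unip.
Proof.
move=> bB; have [h hH E] := torus_exists bB; exists h^-1%g; first exact: torusV.
have hB := subsetP torus_sub_borel _ hH.
have bhB : (b * h^-1)%g \in B by apply: borelM => //; apply: borelV.
apply/unipP; split=> [|i]; first by apply/borelP.
apply: (mulIf (GLval_diag_neq0 i hB)).
by rewrite -borel_diagM // mulgKV E mul1r.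
Qed.

Lemma torus_norm_perm (h : G) s : h \in torus -> ((P s)^-1 * h * P s)%g \in B.
Proof.
move=> /torusP H; apply/weyl_borel => i j ij; apply: H.
by apply: contraTneq ij => ->; rewrite ltnn.
Qed.

Lemma unip_torus1 (g : G) : g \in unip -> g \in torus -> g = 1%g.
Proof.
move=> /unipP[_ H1] /torusP H0; apply: GL_inj => i j; rewrite GLval1.
by have [<-|/H0] := eqVneq i j; rewrite ?H1.
Qed.

Implicit Types (g h u : G) (i j k : 'I_N).

Lemma elem_subproof i j (a : F) : (i < j)%N ->
  \matrix_(k, l) ((k == l)%:R + a *+ ((k == i) && (l == j))) \is a @GRing.unit 'M[F]_N.
Proof.
move=> ij; rewrite unitmxE -det_tr det_trig; last first.
  apply/is_trig_mxP => k l kl; rewrite !mxE -val_eqE gtn_eqF // add0r.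
  case: andP => // -[/eqP lk /eqP ki]; move: kl; rewrite lk ki.
  by rewrite ltnNge ltnW.
apply: rpred_prod => k _.
rewrite !mxE eqxx; case: andP => [[/eqP -> /eqP ji]|_]; last by rewrite addr0 unitr1.
by move: ij; rewrite ji ltnn.
Qed.

Definition elem i j (ij : (i < j)%N) (a : F) : G := FinRing.unit _ (elem_subproof a ij).

Lemma elemE i j (ij : (i < j)%N) a k l :
  GLval (elem ij a) k l = (k == l)%:R + a *+ ((k == i) && (l == j)).
Proof. by rewrite mxE. Qed.

Lemma elem_mulE i j (ij : (i < j)%N) a g k l :
  GLval (elem ij a * g)%g k l = GLval g k l + (a *+ (k == i)) * GLval g j l.
Proof.
rewrite GLvalM mxE; under eq_bigr do rewrite elemE mulrDl.
rewrite big_split /=; congr (_ + _).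
  rewrite (bigD1 k) //= eqxx mul1r big1 ?addr0 // => r.
  by rewrite eq_sym => /negPf->; rewrite mul0r.
rewrite (bigD1 j) //= eqxx andbT big1 ?addr0 // => r /negPf ->.
by rewrite andbF mul0r.
Qed.

Lemma elem_mulEr i j (ij : (i < j)%N) a g k l :
  GLval (g * elem ij a)%g k l = GLval g k l + GLval g k i * (a *+ (l == j)).
Proof.
rewrite GLvalM mxE; under eq_bigr do rewrite elemE mulrDr.
rewrite big_split /=; congr (_ + _).
  by rewrite (bigD1 l) //= eqxx mulr1 big1 ?addr0 // => r /negPf->; rewrite mulr0.
by rewrite (bigD1 i) //= eqxx big1 ?addr0 // => r /negPf ->; rewrite mulr0.
Qed.

Lemma elemV i j (ij : (i < j)%N) a : (elem ij a)^-1%g = elem ij (- a).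
Proof.
apply: (mulgI (elem ij a)); rewrite mulgV; apply: GL_inj => k l.
have /negPf ji : j != i by rewrite -val_eqE gtn_eqF.
rewrite elem_mulE !elemE GLval1 ji mulr0n addr0 (eq_sym j l).
by case: (k == i); case: (l == j);
  rewrite /= ?mulr0n ?mulr1n ?mul0r ?mulr0 ?mulr1 ?addr0 ?subrK.
Qed.

Lemma elem_unip i j (ij : (i < j)%N) a : elem ij a \in unip.
Proof.
apply/unipP; split=> [k l lk|k]; rewrite elemE.
  rewrite -val_eqE gtn_eqF // add0r; case: andP => // -[/eqP ki /eqP lj].
  by move: lk; rewrite ki lj ltnNge ltnW.
rewrite eqxx; case: andP => [[/eqP -> /eqP ji]|_]; last by rewrite addr0.
by move: ij; rewrite ji ltnn.
Qed.

(** With [a] the entry of [u] at [(i, i+1)], take [x = x(a)] and [y = x(1/a)];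
the identity behind the last condition is the one between [2 x 2] matrices that
expresses a lower unitriangular matrix through the upper triangular ones and the
transposition. *)
Lemma GL_rank1 (i j : 'I_N) u : j = i.+1 :> nat -> u \in unip ->
    let s := P (tperm i j) in
    let Q := fixes_cells B P i j in
    (s * u * s)%g \in unip \/
    exists u1 x y, [/\ u = (u1 * x)%g, (s * u1 * s)%g \in unip, y \in unip &
      [/\ Q x, Q y & Q (s * y^-1 * s * x * s)%g]].
Proof.
move=> jE uU s Q; have ij : (i < j)%N by rewrite jE.
have nij : i != j by rewrite -val_eqE ltn_eqF.
have sE g k l : GLval (s * g)%g k l = GLval g (tperm i j k) l by rewrite weyl_mulE.
have sEr g k l : GLval (g * s)%g k l = GLval g k (tperm i j l) by rewrite weyl_mulEr tpermV.
have sus v : v \in unip -> GLval v i j = 0 -> (s * v * s)%g \in unip.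
  move=> /unipP[v0 v1] vij; apply/unipP; split=> [k l lk|k]; rewrite sEr sE //.
  case: (tpermP i j k) lk => [-> li|-> lj|ki kj lk].
  - case: (tpermP i j l) li => [->|->|_ _ li]; rewrite ?ltnn //.
      by rewrite jE ltnNge leqnSn.
    by rewrite v0 // jE ltnS ltnW.
  - case: (tpermP i j l) lj => [->|->|li _]; rewrite ?ltnn // jE ltnS => lj.
    by rewrite v0 // ltn_neqAle lj andbT; apply/eqP => /val_inj.
  case: (tpermP i j l) lk => [->|->|_ _ lk]; last exact: v0.
    move=> lk; rewrite v0 // ltn_neqAle [in (j <= k)%N]jE lk andbT.
    by apply/eqP => /val_inj/esym.
  by move=> lk; rewrite v0 // (ltn_trans ij).
have QP b : (forall k l, k != l -> (k, l) != (i, j) -> GLval b k l = 0) -> Q b.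
  move=> b0 t tij; apply/weyl_borel => k l tlk; apply: b0.
    by apply: contraTneq tlk => ->; rewrite ltnn.
  by apply: contraTneq tlk => -[-> ->]; rewrite ltnNge ltnW.
have [uij|uij] := eqVneq (GLval u i j) 0; [by left; apply: sus | right].
have [_ u1] := unipP _ uU; set a := GLval u i j in uij.
have xU := elem_unip ij a.
have Qe c : Q (elem ij c).
  apply: QP => k l kl; rewrite xpair_eqE elemE (negPf kl) add0r => /negPf ->.
  by rewrite mulr0n.
exists (u * (elem ij a)^-1)%g, (elem ij a), (elem ij a^-1); split.
- by rewrite mulgKV.
- apply: sus; first by rewrite groupM ?groupV.
  by rewrite elemV elem_mulEr u1 eqxx mul1r subrr.
- exact: elem_unip.
split=> //; apply: QP => k l kl klij.
(* the choice of [y] makes the entry at [(j, i)] vanish *)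
rewrite elemV -!mulgA sE elem_mulE !sE !sEr !elemE tpermR.
have tE x y : (tperm i j x == y) = (x == tperm i j y).
  by rewrite (can2_eq (tpermK i j) (tpermK i j)).
rewrite tpermK !tE tpermL tpermR eqxx [i == _]eq_sym tE tpermL /=.
have [kj|kj] := eqVneq k j.
  move: kl; rewrite kj eq_sym => /negPf lj.
  rewrite [j == _]eq_sym tE tpermR [j == i]eq_sym (negPf nij) lj /= mulr0n addr0 add0r.
  by case: (l == i); rewrite /= ?mulr0n ?mulr0 ?addr0 // !mulr1n mulNr mulVf // subrr.
rewrite mulr0n mul0r addr0; have [ki|ki] := eqVneq k i.
  move: kl klij; rewrite ki xpair_eqE eqxx /= => il lj.
  by rewrite eq_sym tE tpermL (negPf lj) (eq_sym l) (negPf il) mulr0n addr0.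
have tkk : tperm i j k = k by rewrite tpermD // eq_sym.
by rewrite mulr0n addr0 -tE tkk (negPf kl).
Qed.

Definition opp_perm : 'S_N := perm (@rev_ord_inj N).

(** Conjugating by the order-reversing permutation turns upper triangular
matrices into lower triangular ones. *)
Lemma unip_opposite u : u \in unip -> ((P opp_perm)^-1 * u * P opp_perm)%g \in B -> u = 1%g.
Proof.
move=> /unipP[u0 u1] /weyl_borel H; apply: GL_inj => i j; rewrite GLval1.
case: (ltngtP i j) => [ij|ji|/val_inj <-]; last by rewrite u1 eqxx.
  rewrite -val_eqE ltn_eqF // mulr0n; apply: H; rewrite !permE /=.
  by apply: ltn_sub2l; rewrite ?ltnS // (leq_trans ij) // -ltnS.
by rewrite -val_eqE gtn_eqF // u0.
Qed.

(** The transposition of [i] and [i + d + 1] is conjugate to that of [i] and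
[i + d] by a simple reflection, so all permutation matrices are reached.  An LUP
decomposition then concludes: the lower triangular factor is conjugate, by the
order-reversing permutation, to an upper triangular matrix. *)
Lemma weyl_gen (X : G -> Prop) : (forall g h, X g -> X h -> X (g * h)%g) ->
    (forall b, b \in B -> X b) ->
    (forall i j, j = i.+1 :> nat -> X (P (tperm i j))) ->
    forall g, X g.
Proof.
move=> XM XB Xs.
have Xt d i j : (j = i + d :> nat)%N -> X (P (tperm i j)).
  elim: d i j => [|d IH] i j jE.
    have -> : j = i by apply: val_inj; rewrite /= jE addn0.
    by rewrite tperm1 weyl1; apply: XB; rewrite group1.
  have kN : (i + d < N)%N by apply: leq_trans (ltn_ord j); rewrite ltnS jE addnS.
  pose k := Ordinal kN.
  have [d0|dgt0] := posnP d; first by apply: Xs; rewrite jE d0 addn1.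
  have ik : i != k by rewrite -val_eqE neq_ltn /= -[X in (X < _)%N]addn0 ltn_add2l dgt0.
  have jk : k != j by rewrite -val_eqE neq_ltn /= jE addnS ltnSn.
  have ij : i != j by rewrite -val_eqE neq_ltn /= jE -[X in (X < _)%N]addn0 ltn_add2l.
  have -> : tperm i j = (tperm i k ^ tperm k j)%g.
    by rewrite tpermJ tpermL tpermD // eq_sym.
  have kj : j = k.+1 :> nat by rewrite jE addnS.
  rewrite conjgE tpermV !weylM.
  by apply: (XM); [apply: Xs | apply: (XM); [apply: IH | apply: Xs]].
have XP s : X (P s).
  have [ts -> _] := prod_tpermP s; elim: ts => [|[i j] ts IH].
    by rewrite big_nil weyl1; apply: XB; rewrite group1.
  rewrite big_cons weylM; apply: XM => //=.
  case: (leqP i j) => [ij|/ltnW ij]; first by apply: (Xt (j - i)%N); rewrite subnKC.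
  by rewrite tpermC; apply: (Xt (i - j)%N); rewrite subnKC.
move=> g.
have /is_perm_mxP[s sE] := cormen_lup_perm (GLval g).
have lE := cormen_lup_correct (GLval g).
have := cormen_lup_detL (GLval g).
have := @cormen_lup_lower _ _ (GLval g); have := @cormen_lup_upper _ _ (GLval g).
case: (cormen_lup _) sE lE => [[p L] V] /= -> pgE V0 L0 Ldet.
have Lu : L \is a GRing.unit by rewrite unitmxE Ldet unitr1.
have Vu : V \is a GRing.unit.
  have := congr1 (mulmx (invmx L)) pgE; rewrite mulKmx // => <-.
  by rewrite !(unitmx_mul, unitmx_inv) Lu unitmx_perm; exact: valP g.
pose l : G := FinRing.unit _ Lu; pose v : G := FinRing.unit _ Vu.
(* the middle factor is the lower triangular factor, rewritten so as to show
   its upper triangular conjugate *)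
have gE : (g = P s^-1 * (P opp_perm * ((P opp_perm)^-1 * l * P opp_perm) * (P opp_perm)^-1) * v)%g.
  rewrite weylV; apply: (mulgI (P s)); rewrite !mulgA mulgV mul1g mulgV mul1g.
  by rewrite mulgK; apply: val_inj.
have lB : ((P opp_perm)^-1 * l * P opp_perm)%g \in B.
  apply/weyl_borel => i j; rewrite !permE /= => ij.
  have {}ij : (i < j)%N.
    by rewrite ltnNge; apply: contraTN ij => ji; rewrite -leqNgt leq_sub2l.
  by rewrite (L0 i j (ltnW ij)); case: eqP ij => [->|//]; rewrite ltnn.
have vB : v \in B by apply/borelP => i j ij; exact: (V0 i j ij).
have XPV : X (P opp_perm)^-1%g by rewrite -weylV.
rewrite gE; apply: (XM); last exact: XB.
apply: (XM) => //; apply: (XM) => //; apply: (XM) => //; exact: XB.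
Qed.

Definition GL_bn : bn_data G N :=
  @BNData G N (borel_group F n) unip_group torus_group P opp_perm weylM
    unip_sub_borel torus_sub_borel borel_torus_coset (@unip_torus1) torus_norm_perm
    borel_perm_eq unip_opposite GL_rank1 weyl_gen.

End Borel.

(** * Matrices over a local principal ideal domain *)

Definition multiples (R : idomainType) (g : R) : {pred R} :=
  [pred y | `[< exists z, y = g * z >]].

Lemma multiplesP (R : idomainType) (g y : R) :
  reflect (exists z, y = g * z) (y \in multiples g).
Proof. by rewrite inE; apply: asboolP. Qed.

Lemma multiples_ideal (R : idomainType) (g : R) :
  g \isn't a GRing.unit -> idealr_closed (multiples g).
Proof.
move=> gU; split=> [||a y z].
- by apply/multiplesP; exists 0; rewrite mulr0.
- apply/multiplesP => -[z gz]; case/negP: gU; apply/unitrPr; exists z; exact: esym.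
move=> /multiplesP[y' ->] /multiplesP[z' ->]; apply/multiplesP; exists (a * y' + z').
by rewrite mulrDr mulrCA.
Qed.

(** If no maximal ideal contains [x], every proper principal ideal containing [x]
is strictly contained in another one.  The union of an infinite strictly
increasing chain built in this way is a proper ideal, hence principal, and its
generator already belongs to a member of the chain. *)
Lemma nonunit_maximal (R : idomainType) (x : R) : principal_ideal_ring R ->
  x \isn't a GRing.unit -> exists2 S : {pred R}, maximal_ideal S & x \in S.
Proof.
move=> hpid xU; apply: contrapT => noS.
pose P g := g \isn't a GRing.unit /\ x \in multiples g.
have mulxx (g : R) : g \in multiples g by apply/multiplesP; exists 1; rewrite mulr1.
have step g : exists h, P g -> [/\ P h, g \in multiples h & h \notin multiples g].
  have [[gU xg]|nP] := pselect (P g); last by exists 0 => /nP.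
  apply: contrapT => noh; apply: noS; exists (multiples g) => //.
  split=> [|T Tid gT y]; first exact: multiples_ideal.
  apply/idP/idP => [yT|]; last exact: gT.
  have [h hT] := hpid T Tid.
  have hTE z : (z \in T) = (z \in multiples h).
    by apply/idP/idP => [/hT H|/multiplesP H]; [apply/multiplesP|apply/hT].
  have gh : g \in multiples h by rewrite -hTE; apply: gT.
  have [/multiplesP[u hE]|hg] := boolP (h \in multiples g).
    have /multiplesP[v ->] : y \in multiples h by rewrite -hTE.
    by apply/multiplesP; exists (u * v); rewrite hE mulrA.
  case: noh; exists h => _; split=> //; split; last by rewrite -hTE; apply: gT.
  apply/negP => hU; case: Tid => _ /negP[]; rewrite hTE; apply/multiplesP.
  by exists h^-1; rewrite mulrV.
have [f fP] := choice step.
have gP k : P (iter k f x).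
  by elim: k => [|k /fP[]] //; split.
have [|u uP] := hpid [pred y | `[< exists k, y \in multiples (iter k f x) >]].
  have mono y i j : y \in multiples (iter i f x) -> y \in multiples (iter (j + i) f x).
    move=> yi; elim: j => [//|j /multiplesP[z ->]].
    have [_ /multiplesP[w gE] _] := fP _ (gP (j + i)%N).
    by apply/multiplesP; exists (w * z); rewrite mulrA /= -gE.
  split=> [||a y z]; rewrite ?inE.
  - by apply/asboolP; exists 0%N; apply/multiplesP; exists 0; rewrite mulr0.
  - by apply/asboolP => -[k]; case: (multiples_ideal (gP k).1) => _ /negP.
  move=> /asboolP[i yi] /asboolP[j zj]; apply/asboolP; exists (j + i)%N.
  case: (multiples_ideal (gP (j + i)%N).1) => _ _; apply; first exact: mono.
  by rewrite addnC; apply: mono.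
have : u \in [pred y | `[< exists k, y \in multiples (iter k f x) >]].
  by apply/uP; exists 1; rewrite mulr1.
rewrite inE => /asboolP[k /multiplesP[w uE]].
have [_ _ /negP[]] := fP _ (gP k).
have /uP[z ->] : f (iter k f x) \in [pred y | `[< exists k, y \in multiples (iter k f x) >]].
  by rewrite inE; apply/asboolP; exists k.+1; apply: mulxx.
by rewrite uE -mulrA; apply/multiplesP; exists (w * z).
Qed.

Section LocalPID.
Variables (R : idomainType) (m : idealr R) (t : R).
Hypotheses (hpid : principal_ideal_ring R) (hloc : local_with m).
Hypothesis (hm : generated_by m t).

Lemma unit_or_max (x : R) : x \is a GRing.unit \/ x \in m.
Proof.
case: (boolP (x \is a GRing.unit)) => [|/(nonunit_maximal hpid)[S Smax xS]]; first by left.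
by right; rewrite -(hloc.2 _ Smax).
Qed.

Lemma unit_or_dvd (x : R) : x \is a GRing.unit \/ exists y, x = t * y.
Proof. by have [|/hm] := unit_or_max x; [left | right]. Qed.

Lemma local_sum_unit (a b : R) : a + b = 1 -> a \is a GRing.unit \/ b \is a GRing.unit.
Proof.
move=> ab; have [|am] := unit_or_max a; first by left.
have [|bm] := unit_or_max b; first by right.
by have : 1 \in m; [rewrite -ab rpredD | rewrite idealr1].
Qed.

(** A generator [g] of the ideal of [a] and [b] is a combination of them; after
dividing by [g], one of the two summands of [1] is a unit, so [a] or [b] itself
generates the ideal. *)
Lemma dvd_total (a b : R) : (exists c, b = a * c) \/ (exists c, a = b * c).
Proof.
pose S := [pred z | `[< exists x y, z = x * a + y * b >]].
have aS : a \in S by rewrite inE; apply/asboolP; exists 1, 0; rewrite mul1r mul0r addr0.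
have bS : b \in S by rewrite inE; apply/asboolP; exists 0, 1; rewrite mul1r mul0r add0r.
have unit_case (a' b' x y : R) : x * a' + y * b' = 1 ->
    (exists c, b' = a' * c) \/ (exists c, a' = b' * c).
  move=> /local_sum_unit[]; rewrite unitrM => /andP[_ U].
    by left; exists (a'^-1 * b'); rewrite mulVKr.
  by right; exists (b'^-1 * a'); rewrite mulVKr.
case: (boolP (1 \in S)) => [|S1].
  by rewrite inE => /asboolP[x [y /esym/unit_case]].
have /hpid[g gS] : idealr_closed S.
  split=> // [|u z1 z2]; rewrite !inE.
    by apply/asboolP; exists 0, 0; rewrite !mul0r addr0.
  move=> /asboolP[x1 [y1 ->]] /asboolP[x2 [y2 ->]]; apply/asboolP.
  by exists (u * x1 + x2), (u * y1 + y2); rewrite !mulrDl mulrDr !mulrA addrACA.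
have [a' aE] := (gS a).1 aS; have [b' bE] := (gS b).1 bS.
have [g0|gN0] := eqVneq g 0; first by left; exists 0; rewrite mulr0 bE g0 mul0r.
have : g \in S by apply/gS; exists 1; rewrite mulr1.
rewrite inE => /asboolP[x [y gE]].
have /unit_case : x * a' + y * b' = 1.
  by apply: (mulfI gN0); rewrite mulr1 mulrDr !(mulrCA g) -aE -bE -gE.
by case=> -[c E]; [left | right]; exists c; rewrite aE bE E mulrA.
Qed.

Lemma dvd_pow_total k (d : R) :
  (exists r, t ^+ k = d * r) \/ (exists r, d = t ^+ k.+1 * r).
Proof.
elim: k => [|k [[r E]|[r ->]]].
- have [dU|[y ->]] := unit_or_dvd d; last by right; exists y; rewrite expr1.
  by left; exists d^-1; rewrite mulrV.
- by left; exists (r * t); rewrite exprSr E mulrA.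
have [rU|[y ->]] := unit_or_dvd r; last by right; exists y; rewrite mulrA -exprSr.
by left; exists r^-1; rewrite mulrK.
Qed.

Lemma dvd_least (I : eqType) (s : seq I) (i0 : I) (f : I -> R) :
  i0 \in s -> exists2 i, i \in s & forall j, j \in s -> exists c, f j = f i * c.
Proof.
elim: s i0 => // i s IH i0 _.
case: s IH => [|j s] IH.
  exists i; rewrite ?mem_head // => j; rewrite inE => /eqP ->.
  by exists 1; rewrite mulr1.
have [k ks kmin] := IH j (mem_head _ _).
have [[c kE]|[c iE]] := dvd_total (f i) (f k).
  exists i; first exact: mem_head.
  move=> j'; rewrite inE => /predU1P[->|/kmin[c' ->]]; first by exists 1; rewrite mulr1.
  by exists (c * c'); rewrite kE mulrA.
exists k; first by rewrite inE ks orbT.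
by move=> j'; rewrite inE => /predU1P[->|/kmin //]; exists c.
Qed.

(** Divisibility is a total preorder, so some entry divides all the others; moved
to the upper left corner, it clears its row and its column. *)
Lemma diagonalize n (A : 'M[R]_n) :
  exists P Q : 'M[R]_n, [/\ P \in unitmx, Q \in unitmx & is_diag_mx (P *m A *m Q)].
Proof.
elim: n A => [|n IH] A.
  by exists 1%:M, 1%:M; rewrite !unitmx1; split=> //; apply/is_diag_mxP => -[].
have [[i j] _ ijmin] := @dvd_least _ (enum {: 'I_n.+1 * 'I_n.+1})
   (ord0, ord0) (fun ij => A ij.1 ij.2) (etrans (mem_enum _ _) isT).
set a := A (i, j).1 (i, j).2 in ijmin.
have [A1 A1def A1E] : exists2 A1 : 'M_(1 + n),
    A1 = tperm_mx ord0 i *m A *m tperm_mx ord0 j &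
    forall k l, A1 k l = A (tperm ord0 i k) (tperm ord0 j l).
  by eexists=> [|k l]; [reflexivity | rewrite -xcolE -xrowE !mxE].
have /choice[c cE] (kl : 'I_(1 + n) * 'I_(1 + n)) : exists c, A1 kl.1 kl.2 = a * c.
  by case: kl => k l; rewrite A1E; apply: (ijmin (_, _)); rewrite mem_enum.
pose v : 'rV_n := \row_k c (lshift n 0, rshift 1 k).
pose w : 'cV_n := \col_k c (rshift 1 k, lshift n 0).
pose C : 'M_n := drsubmx A1.
have A1B : A1 = block_mx a%:M (a *: v) (a *: w) C.
  rewrite -[LHS]submxK; congr block_mx; apply/matrixP => k l; rewrite !mxE ?ord1.
  - by rewrite A1E [lshift _ _](_ : _ = ord0) ?tpermL //; apply: val_inj.
  - by rewrite (cE (_, _)).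
  - by rewrite (cE (_, _)).
have [P' [Q' [P'u Q'u dD]]] := IH (C - a *: (w *m v)).
(* [L1] clears the first column and [R1] the first row *)
pose L1 : 'M_(1 + n) := block_mx 1%:M 0 (- w) 1%:M.
pose R1 : 'M_(1 + n) := block_mx 1%:M (- v) 0 1%:M.
pose L2 : 'M_(1 + n) := block_mx 1%:M 0 0 P'.
pose R2 : 'M_(1 + n) := block_mx 1%:M 0 0 Q'.
have E1 : L2 *m (L1 *m A1 *m R1) *m R2 =
    block_mx a%:M 0 0 (P' *m (C - a *: (w *m v)) *m Q').
  rewrite A1B !mulmx_block !(mulmx0, mul0mx, mul1mx, mulmx1, addr0, add0r).
  rewrite mul_scalar_mx scalerN addNr mulNmx mul_mx_scalar addNr.
  by rewrite !(mulmx0, mul0mx, add0r) mulNmx -scalemxAr addrC.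
have L1u : L1 \in unitmx by rewrite unitmxE det_lblock !det1 mul1r unitr1.
have R1u : R1 \in unitmx by rewrite unitmxE det_ublock !det1 mul1r unitr1.
have L2u : L2 \in unitmx by rewrite unitmxE det_lblock det1 mul1r -unitmxE.
have R2u : R2 \in unitmx by rewrite unitmxE det_ublock det1 mul1r -unitmxE.
exists (L2 *m L1 *m tperm_mx ord0 i), (tperm_mx ord0 j *m R1 *m R2); split.
- by rewrite (unitmx_mul (L2 *m L1)) (unitmx_mul L2) unitmx_perm L2u L1u.
- by rewrite (unitmx_mul _ R2) (unitmx_mul _ R1) unitmx_perm R2u R1u.
have -> : L2 *m L1 *m tperm_mx ord0 i *m A *m (tperm_mx ord0 j *m R1 *m R2) =
          L2 *m (L1 *m A1 *m R1) *m R2 by rewrite A1def !mulmxA.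
have dB : @is_diag_mx R (1 + n) (1 + n)
    (block_mx a%:M 0 0 (P' *m (C - a *: (w *m v)) *m Q')).
  rewrite is_diag_block_mx // !eqxx dD /= andbT.
  by apply/is_diag_mxP => k l; rewrite !ord1.
by rewrite E1.
Qed.

(** Read for a Gram matrix [A]: a functional [phi] that is divisible by [t] on
the vectors [y] with [A y] divisible by [t^(c+1)] agrees modulo [t], after
multiplication by [t^c], with the pairing with some vector [x].  For a diagonal
matrix there is one condition for each diagonal entry [d]: either [d] divides
[t^c], and the equation can be solved, or [t^(c+1)] divides [d], in which case
the hypothesis applies to the basis vector and [x = 0] will do. *)
Lemma dual_image n (A : 'M[R]_n) c (phi : 'rV[R]_n) :
  (forall y : 'cV_n, (exists z, A *m y = t ^+ c.+1 *: z) -> (phi *m y) 0 0 \in m) ->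
  exists x z : 'rV_n, x *m A = t ^+ c *: phi + t ^+ c.+1 *: z.
Proof.
move=> phiP; have [P [Q [Pu Qu dD]]] := diagonalize A.
have [D /is_diag_mxP D0 AE] : exists2 D, is_diag_mx D & A = invmx P *m D *m invmx Q.
  by exists (P *m A *m Q) => //; rewrite !mulmxA mulVmx // mul1mx mulmxK.
have [x xE] : exists xz : 'rV[R]_n * 'rV[R]_n, forall i,
    xz.1 0 i * D i i = t ^+ c * (phi *m Q) 0 i + t ^+ c.+1 * xz.2 0 i.
  have /choice[f fE] i : exists xz : R * R,
      xz.1 * D i i = t ^+ c * (phi *m Q) 0 i + t ^+ c.+1 * xz.2.
    have [[r E]|[r E]] := dvd_pow_total c (D i i).
      by exists ((phi *m Q) 0 i * r, 0); rewrite mulr0 addr0 E /= mulrAC [RHS]mulrC mulrA.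
    have /hm[s sE] : (phi *m Q) 0 i \in m.
      have -> : (phi *m Q) 0 i = (phi *m (Q *m delta_mx i (0 : 'I_1))) 0 0.
        by rewrite mulmxA -colE [RHS]mxE.
      apply: phiP; exists (invmx P *m (r *: delta_mx i 0)).
      rewrite AE -!mulmxA mulKmx // scalemxAr; congr (_ *m _).
      rewrite -colE scalerA -E; apply/matrixP => k l; rewrite !mxE ord1 eqxx andbT.
      by have [->|ki] := eqVneq k i; [rewrite mulr1 | rewrite mulr0 D0].
    by exists (0, - s); rewrite sE /= mul0r mulrN mulrA -exprSr subrr.
  exists (\row_i (f i).1, \row_i (f i).2) => i.
  by rewrite [X in X * _]mxE [X in _ + _ * X]mxE fE.
exists (x.1 *m P), (x.2 *m invmx Q).
have -> : x.1 *m P *m A = x.1 *m D *m invmx Q by rewrite AE !mulmxA mulmxK.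
have -> : x.1 *m D = t ^+ c *: (phi *m Q) + t ^+ c.+1 *: x.2.
  apply/rowP => i; rewrite [LHS]mxE (bigD1 i) //= big1 ?addr0 => [|k ki].
    by rewrite xE !mxE.
  by rewrite D0 ?mulr0.
by rewrite mulmxDl -!scalemxAl mulmxK.
Qed.
End LocalPID.

(** * Isomorphism theorems and composition series *)

Lemma inj_surj_bijective (T T' : Type) (f : T -> T') :
  injective f -> (forall y, exists x, f x = y) -> bijective f.
Proof.
by move=> fI /choice[g gK]; exists g => // x; apply: fI; rewrite gK.
Qed.

Section Modules.
Variable A : pzRingType.
Implicit Types M N Q : lmodType A.

Lemma linear_packed M N (f : M -> N) : linear f -> exists g : {linear M -> N}, g =1 f.
Proof.
move=> lf; pose g : {linear M -> N} := HB.pack f (GRing.isLinear.Build A M N _ f lf).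
by exists g.
Qed.

Lemma lmod_iso_refl M : lmod_iso M M.
Proof.
have [f fE] := @linear_packed M M id (fun _ _ _ => erefl).
by exists f; exists id => x; rewrite fE.
Qed.

Lemma lmod_iso_sym M N : lmod_iso M N -> lmod_iso N M.
Proof.
move=> [f [g fK gK]]; have lg : linear g.
  by move=> a x y; apply: (can_inj fK); rewrite linearP !gK.
have [h hE] := linear_packed lg; exists h; exists f => x; rewrite hE //.
Qed.

Lemma lmod_iso_trans M N Q : lmod_iso M N -> lmod_iso N Q -> lmod_iso M Q.
Proof.
move=> [f fB] [g gB]; have lgf : linear (g \o f) by move=> a x y; rewrite /= !linearP.
by have [h hE] := linear_packed lgf; exists h; apply: (eq_bij (bij_comp gB fB)) => x.
Qed.

Lemma simple_mod_iso M N : lmod_iso M N -> simple_mod M -> simple_mod N.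
Proof.
move=> [f [g fK gK]] [[x x0] sM]; split.
  exists (f x); apply: contra_neq x0 => fx0.
  by rewrite -[x]fK fx0 -(linear0 f) fK.
move=> S; pose T : {pred M} := [pred x | f x \in S].
have Tcl : submod_closed T.
  by split=> [|a y z]; rewrite !inE ?linear0 ?rpred0 // linearP => *; rewrite rpredD ?rpredZ.
case: (sM (Submodule Tcl)) => [T0|TT]; [left|right] => y.
  by move=> yS; rewrite -[y]gK (T0 (g y)) ?linear0 //= inE gK.
by rewrite -[y]gK; apply: (TT (g y)).
Qed.

Section QuoLift.
Variables (M N : lmodType A) (S : submodule M).

Lemma quo_lift (f : {linear M -> N}) : (forall x, x \in S -> f x = 0) ->
  exists g : {linear quo_mod S -> N}, forall x, g (quo_pi S x) = f x.
Proof.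
move=> f0; pose g (u : quo_mod S) := f (repr (u : Quotient.quot S)).
have gE x : g (quo_pi S x) = f x.
  apply/eqP; rewrite -subr_eq0 -linearB f0 // -quo_piE /quo_pi; apply/eqP.
  exact: reprK.
have lg : linear g.
  move=> a u v; have [x <-] := quo_pi_surj u; have [y <-] := quo_pi_surj v.
  by rewrite -linearP !gE linearP.
by have [h hE] := linear_packed lg; exists h => x; rewrite hE gE.
Qed.

Lemma first_iso (f : {linear M -> N}) :
  (forall y, exists x, f x = y) -> (forall x, (f x == 0) = (x \in S)) ->
  lmod_iso (quo_mod S) N.
Proof.
move=> fS fK; have [|g gE] := @quo_lift f.
  by move=> x xS; apply/eqP; rewrite fK.
exists g; apply: inj_surj_bijective => [u v|y]; last first.
  by have [x <-] := fS y; exists (quo_pi S x).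
have [x <-] := quo_pi_surj u; have [y <-] := quo_pi_surj v.
by rewrite !gE => /eqP; rewrite -subr_eq0 -linearB fK -quo_piE => /eqP.
Qed.
End QuoLift.

Lemma quo_pi_eq0 M (S : submodule M) x : (quo_pi S x == 0) = (x \in S).
Proof. by rewrite -(linear0 (quo_pi S)) quo_piE subr0. Qed.

(** The noetherian isomorphism theorems in the form used below: [f] need not map
[M1] onto [N1], only onto it modulo [N0]. *)
Lemma subquo_iso M N (f : {linear M -> N}) (M1 M0 : submodule M) (N1 N0 : submodule N) :
  (forall x, x \in M1 -> f x \in N1) ->
  (forall y, y \in N1 -> exists2 x, x \in M1 & y - f x \in N0) ->
  (forall x, x \in M1 -> (f x \in N0) = (x \in M0)) ->
  lmod_iso (subquo M1 M0) (subquo N1 N0).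
Proof.
move=> f1 f1S f0.
pose g (x : submod_of M1) := quo_pi (sub_in N1 N0) (Submod (f1 _ (submod_valP x))).
have lg : linear g.
  move=> a x y; rewrite -linearP; congr quo_pi; apply: val_inj => /=.
  by rewrite linearP.
have [h hE] := linear_packed lg.
apply: (first_iso (f := h)) => [u|x]; last first.
  by rewrite hE /g quo_pi_eq0 /= !inE /= f0 // submod_valP.
have [[y yN] <-] := quo_pi_surj u; have [x xM xy] := f1S y yN.
exists (Submod xM); rewrite hE; apply/eqP; rewrite quo_piE -rpredN opprB.
by rewrite inE.
Qed.

Section Extension.
Variables (M N Q : lmodType A) (i : {linear N -> M}) (p : {linear M -> Q}).
Hypotheses (iI : injective i) (pS : forall y, exists x, p x = y).
Hypothesis (ip : forall x, p x = 0 <-> exists z, x = i z).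

Definition image_mod_pred (S : submodule N) : {pred M} :=
  [pred x | `[< exists2 z, z \in S & x = i z >]].

Lemma image_mod_closed (S : submodule N) : submod_closed (image_mod_pred S).
Proof.
split=> [|a x y]; rewrite !inE.
  by apply/asboolP; exists 0; rewrite ?rpred0 ?linear0.
move=> /asboolP[x' xS ->] /asboolP[y' yS ->]; apply/asboolP.
by exists (a *: x' + y'); rewrite ?linearP // rpredD ?rpredZ.
Qed.
Definition image_mod S := Submodule (image_mod_closed S).

Lemma image_modP (S : submodule N) x : reflect (exists2 z, z \in S & x = i z) (x \in image_mod S).
Proof. exact: asboolP. Qed.

Definition preim_mod_pred (S : submodule Q) : {pred M} := [pred x | p x \in S].

Lemma preim_mod_closed (S : submodule Q) : submod_closed (preim_mod_pred S).
Proof.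
by split=> [|a y z]; rewrite !inE ?linear0 ?rpred0 // linearP => *; rewrite rpredD ?rpredZ.
Qed.
Definition preim_mod S := Submodule (preim_mod_closed S).

Variables (sN : nat -> submodule N) (sQ : nat -> submodule Q) (k l : nat).
Hypotheses (cN : composition_series k sN) (cQ : composition_series l sQ).

(** The series of the submodule followed by the inverse images of the series of
the quotient; at the index [k] both descriptions agree. *)
Definition glue_series (j : nat) : submodule M :=
  if (j <= k)%N then image_mod (sN j) else preim_mod (sQ (j - k)).
Local Notation s := glue_series.

Lemma glue_low j : (j <= k)%N -> s j =i image_mod (sN j).
Proof. by rewrite /s => ->. Qed.

Lemma glue_high j x : (x \in s (k + j)) = (p x \in sQ j).
Proof.
case: cN cQ => _ Nk _ _ [Q0 _ _ _]; rewrite /s -{2}[k]addn0 leq_add2l addKn.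
case: j => [|j //]; rewrite addn0 Q0.
apply/image_modP/eqP => [[z _ ->]|/ip[z ->]]; last by exists z.
by apply/ip; exists z.
Qed.

Lemma glue_low_iso j : (j < k)%N ->
  lmod_iso (subquo (s j.+1) (s j)) (subquo (sN j.+1) (sN j)).
Proof.
move=> jk; apply: lmod_iso_sym; apply: (subquo_iso (f := i)) => [x xN|y|x xN].
- by rewrite glue_low //; apply/image_modP; exists x.
- rewrite glue_low // => /image_modP[z zN ->]; exists z => //.
  by rewrite subrr rpred0.
rewrite glue_low ?(ltnW jk) //; apply/image_modP/idP => [[z zN /iI->] //|xj].
by exists x.
Qed.

Lemma glue_high_iso j :
  lmod_iso (subquo (s (k + j).+1) (s (k + j))) (subquo (sQ j.+1) (sQ j)).
Proof.
rewrite -addnS; apply: (subquo_iso (f := p)) => [x|y yQ|x _]; last by rewrite glue_high.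
  by rewrite glue_high.
have [x px] := pS y; exists x; first by rewrite glue_high px.
by rewrite px subrr rpred0.
Qed.

Lemma glue_composition_series : composition_series (k + l) s.
Proof.
case: (cN) (cQ) => N0 Nk Nsub Nsim [Q0 Ql Qsub Qsim]; split=> [x|x|j jkl x|j jkl].
- rewrite glue_low //; apply/image_modP/eqP => [[z]|->].
    by rewrite N0 => /eqP -> ->; rewrite linear0.
  by exists 0; rewrite ?rpred0 ?linear0.
- by rewrite glue_high.
- case: (ltnP j k) => [jk|kj].
    rewrite !glue_low ?(ltnW jk) // => /image_modP[z zN ->].
    by apply/image_modP; exists z => //; apply: Nsub.
  rewrite -(subnKC kj) -addnS !glue_high; apply: Qsub.
  by rewrite ltn_subLR.
case: (ltnP j k) => [jk|kj].
  exact: simple_mod_iso (lmod_iso_sym (glue_low_iso jk)) (Nsim _ jk).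
have jl : (j - k < l)%N by rewrite ltn_subLR.
rewrite -(subnKC kj).
exact: simple_mod_iso (lmod_iso_sym (glue_high_iso _)) (Qsim _ jl).
Qed.
End Extension.

(** A list of indices replaces the permutation of an ordinal type that depends
on the length of [fs]; such lists can be concatenated without casts. *)
Lemma composition_factorsP M (fs : seq (lmodType A)) :
  composition_factors M fs <->
  exists (s : nat -> submodule M) (t : seq nat),
    [/\ perm_eq t (iota 0 (size fs)), composition_series (size fs) s &
        forall i, (i < size fs)%N ->
          lmod_iso (subquo (s (nth 0%N t i).+1) (s (nth 0%N t i))) (nth M fs i)].
Proof.
split=> [[s [sigma [sS sI]]]|[s [t [tP sS sI]]]].
  exists s, [seq (sigma i : nat) | i <- enum 'I_(size fs)]; split=> // [|i ifs].
    apply: uniq_perm; rewrite ?iota_uniq //.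
      by rewrite map_inj_uniq ?enum_uniq // => i j /val_inj/perm_inj.
    move=> j; rewrite mem_iota add0n /=; apply/mapP/idP => [[i _ ->] //|jfs].
    by exists ((sigma^-1)%g (Ordinal jfs)); rewrite ?mem_enum ?permKV.
  have iE : nth 0%N [seq (sigma i : nat) | i <- enum 'I_(size fs)] i = sigma (Ordinal ifs).
    rewrite (nth_map (Ordinal ifs)) ?size_enum_ord //.
    by rewrite (_ : nth _ _ _ = Ordinal ifs) //; exact: (nth_ord_enum _ (Ordinal ifs)).
  by rewrite iE; apply: (sI (Ordinal ifs)).
have tn : size t = size fs by rewrite (perm_size tP) size_iota.
have tlt (i : 'I_(size fs)) : (nth 0%N t i < size fs)%N.
  have : nth 0%N t i \in t by rewrite mem_nth ?tn.
  by rewrite (perm_mem tP) mem_iota.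
have finj : injective (fun i => Ordinal (tlt i)).
  move=> i j [/eqP]; rewrite nth_uniq ?tn // ?(perm_uniq tP) ?iota_uniq //.
  by move=> /eqP/val_inj.
exists s, (perm finj); split=> // i.
by rewrite permE; apply: sI.
Qed.

(** An exact sequence [0 -> N -> M -> Q -> 0]. *)
Lemma composition_factors_ext M N Q (i : {linear N -> M}) (p : {linear M -> Q}) fs gs :
  injective i -> (forall y, exists x, p x = y) ->
  (forall x, p x = 0 <-> exists z, x = i z) ->
  composition_factors N fs -> composition_factors Q gs ->
  composition_factors M (fs ++ gs).
Proof.
move=> iI pS ip /composition_factorsP[sN [tN [tNP cN sNI]]].
move=> /composition_factorsP[sQ [tQ [tQP cQ sQI]]]; apply/composition_factorsP.
have tNn : size tN = size fs by rewrite (perm_size tNP) size_iota.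
exists (glue_series i p sN sQ (size fs)), (tN ++ map (addn (size fs)) tQ); split.
- rewrite size_cat iotaD; apply: perm_cat => //.
  by rewrite add0n -{2}[size fs]addn0 iotaDl perm_map.
- by rewrite size_cat; apply: glue_composition_series.
move=> j; rewrite size_cat => jfg; rewrite !nth_cat tNn; case: ltnP => [jf|fj].
  have jt : (nth 0%N tN j < size fs)%N.
    have : nth 0%N tN j \in tN by rewrite mem_nth ?tNn.
    by rewrite (perm_mem tNP) mem_iota.
  rewrite (set_nth_default N) //.
  by apply: lmod_iso_trans (sNI _ jf); apply: glue_low_iso.
have jg : (j - size fs < size gs)%N by rewrite ltn_subLR.
rewrite (nth_map 0%N) ?(perm_size tQP) ?size_iota // (set_nth_default Q) //.
by apply: lmod_iso_trans (sQI _ jg); apply: (glue_high_iso pS ip cN cQ).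
Qed.

Lemma composition_factors_trivial M : (forall x : M, x = 0) -> composition_factors M [::].
Proof.
move=> M0; have zcl : submod_closed (pred_of_simpl (@predT M)) by split.
exists (fun=> Submodule zcl), 1%g; split=> [|[]//]; split=> // x.
by rewrite [x]M0 eqxx.
Qed.
End Modules.

Lemma composition_factors_iso (A : pzRingType) (M N : lmodType A) fs :
  lmod_iso M N -> composition_factors N fs -> composition_factors M fs.
Proof.
move=> [p pB] cN; have pcl : submod_closed (pred_of_simpl (@predT N)) by split.
pose Z := quo_mod (Submodule pcl).
have Z0 (z : Z) : z = 0.
  by have [x <-] := quo_pi_surj z; apply/eqP; rewrite quo_pi_eq0.
have [i iE] := @linear_packed _ Z M (fun=> 0) (fun a _ _ => esym (etrans (addr0 _) (scaler0 _ a))).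
rewrite -[fs]cat0s.
apply: (composition_factors_ext (i := i) (p := p)) (composition_factors_trivial Z0) cN.
- by move=> x y _; rewrite [x]Z0 [y]Z0.
- by case: pB => q _ qK y; exists (q y).
move=> x; split=> [px|[z ->]]; last by rewrite iE linear0.
by exists 0; rewrite iE; apply: (bij_inj pB); rewrite linear0.
Qed.

(** * Finite length *)

Section FiniteLength.
Variable A : pzRingType.
Implicit Types M N : lmodType A.

(** A bounded rank that is strictly monotone stands for the length, which is thus
never computed. *)
Definition finite_length M : Prop :=
  exists (d : nat) (r : submodule M -> nat), (forall S, r S <= d)%N /\
    forall S T : submodule M, {subset S <= T} -> ~ {subset T <= S} -> (r S < r T)%N.

Section Pullback.
Variables (M : lmodType A) (M1 M0 : submodule M).
Hypothesis M01 : {subset M0 <= M1}.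

Definition pullback_pred (S : submodule (subquo M1 M0)) : {pred M} :=
  [pred x | `[< exists h : x \in M1, quo_pi (sub_in M1 M0) (Submod h) \in S >]].

Lemma pullback_closed S : submod_closed (pullback_pred S).
Proof.
split=> [|a x y]; rewrite !inE.
  apply/asboolP; exists (rpred0 _).
  by rewrite (_ : Submod _ = 0) ?linear0 ?rpred0 //; apply: val_inj.
move=> /asboolP[hx xS] /asboolP[hy yS]; apply/asboolP.
have h : a *: x + y \in M1 by rewrite rpredD ?rpredZ.
exists h; rewrite (_ : Submod h = a *: Submod hx + Submod hy); last exact: val_inj.
by rewrite linearP rpredD ?rpredZ.
Qed.
Definition pullback S := Submodule (pullback_closed S).

Lemma pullbackP S (x : submod_of M1) :
  (val x \in pullback S) = (quo_pi (sub_in M1 M0) x \in S).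
Proof.
case: x => x h /=; apply/asboolP/idP => [[h']|xS]; last by exists h.
by rewrite (_ : Submod h' = Submod h) //; apply: val_inj.
Qed.

Lemma pullback_sub S : {subset pullback S <= M1}.
Proof. by move=> x /asboolP[h]. Qed.

Lemma sub_pullback S : {subset M0 <= pullback S}.
Proof.
move=> x xM0; rewrite (pullbackP S (Submod (M01 xM0))).
rewrite (_ : quo_pi _ _ = 0) ?rpred0 //; apply/eqP.
by rewrite quo_pi_eq0.
Qed.

Lemma pullback_mono (S T : submodule (subquo M1 M0)) :
  {subset pullback S <= pullback T} -> {subset S <= T}.
Proof.
move=> ST u uS; have [x xu] := quo_pi_surj u.
by rewrite -xu -pullbackP; apply: ST; rewrite pullbackP xu.
Qed.

Lemma pullback_subset (S T : submodule (subquo M1 M0)) :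
  {subset S <= T} -> {subset pullback S <= pullback T}.
Proof. by move=> ST x /asboolP[h /ST xT]; apply/asboolP; exists h. Qed.

Lemma finite_length_subquo : finite_length M -> finite_length (subquo M1 M0).
Proof.
move=> [d [r [rd rS]]]; exists d, (r \o pullback); split=> [S|S T ST TS] /=.
  exact: rd.
by apply: rS => [|/pullback_mono //]; apply: pullback_subset.
Qed.
End Pullback.

(** Among the submodules strictly above [S] take one of least rank: the step from
[S] to it is simple, and the rank has increased. *)
Lemma composition_series_above M (S : submodule M) : finite_length M ->
  exists (k : nat) (s : nat -> submodule M),
    [/\ s 0%N = S, forall x, x \in s k,
      forall i, (i < k)%N -> {subset s i <= s i.+1} &
      forall i, (i < k)%N -> simple_mod (subquo (s i.+1) (s i))].
Proof.
move=> [d [r [rd rS]]]; move: {2}(d - r S)%N (leqnn (d - r S)) => e.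
elim: e S => [|e IH] S rSe.
all: have [SM|/existsNP[x0 /negP x0S]] := pselect (forall x, x \in S);
  first by exists 0%N, (fun=> S); split.
- have pcl : submod_closed (pred_of_simpl (@predT M)) by split.
  have := rS S (Submodule pcl) (fun _ _ => isT) (fun H => negP x0S (H x0 isT)).
  by move: rSe; rewrite leqn0 subn_eq0 => dS /(leq_ltn_trans dS); rewrite ltnNge rd.
(* [Q v] says that [v] is the rank of a submodule strictly above [S] *)
pose Q v := `[< exists T : submodule M, [/\ {subset S <= T}, ~ {subset T <= S} & r T = v] >].
have exQ : exists v, Q v.
  have pcl : submod_closed (pred_of_simpl (@predT M)) by split.
  exists (r (Submodule pcl)); apply/asboolP; exists (Submodule pcl); split=> //.
  by move=> /(_ x0 isT); apply/negP.
case: (ex_minnP exQ) => v /asboolP[T [ST TS rT]] vmin.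
have [|k [s [s0 sk sS sI]]] := IH T.
  have lt := rS S T ST TS; rewrite -ltnS; apply: leq_trans rSe; apply: ltn_sub2l => //.
  exact: leq_trans lt (rd T).
exists k.+1, (fun j => if j is j'.+1 then s j' else S); split=> // [[|i]|[|i]] ik //=.
- by rewrite s0.
- exact: sS.
- rewrite s0; split.
    have /existsNP[x /not_implyP[xT /negP xS]] := TS.
    exists (quo_pi _ (Submod xT)); rewrite quo_pi_eq0; exact: xS.
  move=> V; have [VS|VnS] := pselect ({subset pullback V <= S}).
    left=> u uV; have [x xu] := quo_pi_surj u; rewrite -xu.
    by apply/eqP; rewrite quo_pi_eq0; apply: VS; rewrite pullbackP xu.
  right; have [TV|TnV] := pselect ({subset T <= pullback V}).
    by move=> u; have [x <-] := quo_pi_surj u; rewrite -pullbackP TV // submod_valP.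
  have := rS _ _ (@pullback_sub _ _ _ V) TnV; rewrite ltnNge rT vmin //.
  by apply/asboolP; exists (pullback V); split=> //; apply: sub_pullback.
exact: sI.
Qed.

Lemma composition_factors_exist M : finite_length M -> exists fs, composition_factors M fs.
Proof.
move=> fM; have zcl : submod_closed (pred1 (0 : M)).
  by split=> [|a x y]; rewrite !inE // => /eqP -> /eqP ->; rewrite scaler0 addr0.
have [k [s [s0 sk sS sI]]] := composition_series_above (Submodule zcl) fM.
exists [seq subquo (s i.+1) (s i) | i <- iota 0 k]; apply/composition_factorsP.
exists s, (iota 0 k); rewrite size_map size_iota; split=> // [|i ik].
  by split=> // x; rewrite s0.
rewrite (nth_map 0%N) ?size_iota // !nth_iota //.
exact: lmod_iso_refl.
Qed.

(** The rank counts pivots as in Gaussian elimination: [V] is a flag whose steps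
are generated by the [v i], and [i] is a pivot of [S] when [S] contains an
element congruent to [v i] modulo [V i].  If [S] is contained in [T] and they
have the same pivots, an element of [T] can be reduced by elements of [S] until
it vanishes.  The scalars [a] and [b] of the last hypothesis take the place of a
nonzero leading coefficient and its inverse, so that no field is mentioned. *)
Lemma finite_length_flag M (d : nat) (v : nat -> M) (V : nat -> M -> Prop) :
  (forall x, V 0%N x -> x = 0) -> (forall x, V d x) ->
  (forall i x y, V i x -> V i y -> V i (x - y)) ->
  (forall i x, (i < d)%N -> V i.+1 x -> V i x \/ exists a b : A, b * a = 1 /\ V i (a *: x - v i)) ->
  finite_length M.
Proof.
move=> V0 Vd VB Vstep.
pose piv (S : submodule M) : {set 'I_d} :=
  [set i : 'I_d | `[< exists2 z, z \in S & V i (z - v i) >]].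
have pivS (S T : submodule M) : {subset S <= T} -> piv S \subset piv T.
  move=> ST; apply/subsetP => i; rewrite !inE => /asboolP[z /ST zT zi].
  by apply/asboolP; exists z.
exists d, (fun S => #|piv S|); split=> [S|S T ST TS].
  by rewrite (leq_trans (max_card _)) ?card_ord.
rewrite ltn_neqAle subset_leq_card ?pivS // andbT; apply/negP => pE; apply: TS.
have {}pE : piv S = piv T by apply/eqP; rewrite eqEcard pivS // (eqP pE) leqnn.
suff H i x : (i <= d)%N -> V i x -> x \in T -> x \in S by move=> x; apply: (H d).
elim: i x => [|i IH] x id; first by move=> /V0 -> _; rewrite rpred0.
move=> /(Vstep _ _ id)[|[a [b [ba axV]]]] xT; first by apply: IH => //; apply: ltnW.
have : Ordinal id \in piv T.
  by rewrite inE; apply/asboolP; exists (a *: x); rewrite ?rpredZ.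
rewrite -pE inE => /asboolP[z zS zV].
rewrite -[x]scale1r -ba -scalerA rpredZ // -[a *: x](subrK z) rpredD //.
apply: IH; first exact: ltnW.
  have -> : a *: x - z = (a *: x - v i) - (z - v i) by rewrite opprB addrA subrK.
  exact: VB.
by rewrite rpredB ?rpredZ // ST.
Qed.
End FiniteLength.

(** * Dual modules and modules over the residue ring *)

Section DualFun.
Variables (R : comNzRingType) (gT : finGroupType) (M : lmodType (grpalg R gT)).
Implicit Types u v : dual_mod M.

Lemma dual_fun0 x : val (0 : dual_mod M) x = 0. Proof. by []. Qed.
Lemma dual_funD u v x : val (u + v) x = val u x + val v x. Proof. by []. Qed.
Lemma dual_funZ a u x : val (a *: u) x = val u (ga_inv a *: x). Proof. by []. Qed.

Lemma dual_fun_linear u k x y : val u (k%:A *: x + y) = k * val u x + val u y.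
Proof. by have /asboolP := valP u; apply. Qed.

Lemma dual_fun_at0 u : val u 0 = 0.
Proof.
by have := dual_fun_linear u (-1) 0 0; rewrite scaler0 addr0 mulN1r addNr.
Qed.

Lemma dual_modP u v : (forall x, val u x = val v x) -> u = v.
Proof. by move=> uv; apply/val_inj/funext. Qed.
End DualFun.

Lemma dual_iso (R : comNzRingType) (gT : finGroupType) (M N : lmodType (grpalg R gT)) :
  lmod_iso M N -> lmod_iso (dual_mod N) (dual_mod M).
Proof.
move=> [f [g fK gK]].
have pull (P P' : lmodType (grpalg R gT)) (h : {linear P -> P'}) (u : dual_mod P') :
    (val u \o h) \in @linear_form_pred R gT P.
  by apply/asboolP => k x y; rewrite /= linearP dual_fun_linear.
have lg : linear g by move=> a x y; apply: (can_inj fK); rewrite linearP !gK.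
have [g' g'E] := linear_packed lg.
pose F u := DualMod (pull _ _ f u); pose F' u := DualMod (pull _ _ g' u).
have lF : linear F.
  move=> a u v; apply: dual_modP => x.
  by rewrite [RHS]dual_funD [X in _ = X + _]dual_funZ [in RHS]/= linearZ.
have [F1 F1E] := linear_packed lF; exists F1; exists F' => u; apply: dual_modP => x.
  by rewrite F1E /= g'E gK.
by rewrite F1E /= g'E fK.
Qed.

Section ResidueLift.
Variables (R : comNzRingType) (m : idealr R) (gT : finGroupType).
Local Notation RG := (grpalg R gT).
Local Notation KG := (grpalg {ideal_quot m} gT).
Variables (M : lmodType RG) (S : submodule M) (hS : annihilated m (quo_mod S)).

Section Lift.
Variables (N : lmodType KG) (f : M -> N).
Hypothesis fl : forall (a : RG) x y, f (a *: x + y) = ga_red m a *: f x + f y.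

(** A map that is linear along the reduction of coefficients induces a linear map
over the residue group algebra. *)
Lemma residue_lift : (forall x, x \in S -> f x = 0) ->
  exists g : {linear (residue_mod hS) -> N}, forall x, g (quo_pi S x) = f x.
Proof.
move=> f0; pose g (u : residue_mod hS) := f (repr (u : Quotient.quot S)).
have gE x : g (quo_pi S x) = f x.
  rewrite /g; set y := repr _; have /f0 xy0 : x - y \in S.
    by rewrite -quo_piE /quo_pi reprK.
  by rewrite -[x in RHS](subrK y) -[x - y]scale1r fl xy0 scaler0 add0r.
have lg : linear g.
  move=> a u v; have [x <-] := quo_pi_surj u; have [y <-] := quo_pi_surj v.
  rewrite (_ : _ + _ = quo_pi S (ga_lift a *: x + y)); last by rewrite linearP.
  by rewrite !gE fl ga_redK.
by have [h hE] := linear_packed lg; exists h => x; rewrite hE gE.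
Qed.

Lemma residue_iso : (forall y, exists x, f x = y) ->
  (forall x, (f x == 0) = (x \in S)) -> lmod_iso (residue_mod hS) N.
Proof.
move=> fS fK; have [|g gE] := residue_lift.
  by move=> x xS; apply/eqP; rewrite fK.
exists g; apply: inj_surj_bijective => [u v|y]; last first.
  by have [x <-] := fS y; exists (quo_pi S x).
have [x <-] := quo_pi_surj u; have [y <-] := quo_pi_surj v.
have fB : f (x - y) = f x - f y.
  have := fl 1 (x - y) y; rewrite scale1r subrK ga_red1 scale1r => ->.
  by rewrite addrK.
by rewrite !gE => /eqP; rewrite -subr_eq0 -fB fK -quo_piE => /eqP.
Qed.
End Lift.
End ResidueLift.

(** * The Steinberg lattice and its form *)

Section Lattice.
Variables (F : finFieldType) (n : nat) (R : idomainType).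
Hypothesis hchar : [pchar R] =i pred0.
Local Notation G := (matrix_GLtype__canonical__fingroup_FinGroup n F).
Local Notation D := (GL_bn F n).
Local Notation U := (bnU D).
Local Notation RG := (grpalg R G).
Local Notation I := (steinberg_lattice F n R).
Local Notation r := #|U|.
Implicit Types x y : I.

Lemma natr_neq0 k : (0 < k)%N -> k%:R != 0 :> R.
Proof. by move/pcharf0P: hchar => ->; rewrite lt0n. Qed.

Lemma card_neq0 (gT : finGroupType) (A : {group gT}) : #|A|%:R != 0 :> R.
Proof. exact/natr_neq0/cardG_gt0. Qed.

Lemma lattice_eltP x : exists a : RG, lattice_elt x = a * bn_elt R D.
Proof. by case: x => x /= /asboolP. Qed.

Lemma steinberg_elt_mem : (bn_elt R D : RG^o) \in steinberg_ideal F n R.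
Proof. by apply/asboolP; exists 1; rewrite mul1r. Qed.

Definition steinberg_gen : I := Submod steinberg_elt_mem.

Definition steinberg_basis (i : 'I_r) : I := ga_elt R (enum_val i) *: steinberg_gen.
Local Notation e := steinberg_basis.

Definition steinberg_coord x (i : 'I_r) : R :=
  (-1) ^+ bn_long D * lattice_elt x (enum_val i * bnw D (bn_long D))%g.

Lemma steinberg_expand x : x = \sum_i (steinberg_coord x i)%:A *: e i.
Proof.
apply: val_inj; rewrite raddf_sum /=; have [a xE] := lattice_eltP x.
rewrite -/(lattice_elt x) {1}xE bn_coord big_enum_val /=.
apply: eq_bigr => i _; rewrite /steinberg_coord xE.
set c := _ * _; transitivity (c%:A * (ga_elt R (enum_val i) * bn_elt R D) : RG) => //.
by rewrite -scalerAl mul1r.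
Qed.

(** The coordinates of [x] in the basis are among its values up to sign. *)
Lemma lattice_divide (d : R) x :
  (forall g, exists k, lattice_elt x g = d * k) -> exists y, x = d%:A *: y.
Proof.
move=> /choice[k kE]; rewrite (steinberg_expand x).
exists (\sum_i ((-1) ^+ bn_long D * k (enum_val i * bnw D (bn_long D))%g)%:A *: e i).
rewrite scaler_sumr; apply: eq_bigr => i _.
by rewrite [RHS]scale_algA /steinberg_coord kE mulrCA.
Qed.

Lemma borel_neq0 : #|borel F n|%:R != 0 :> R.
Proof. exact: card_neq0 (borel_group F n). Qed.

(** The value in [R] of the form whose values are a priori fractions. *)
Definition stform x y : R := sval (cid (steinberg_form_int x y)).

Lemma stformE x y : steinberg_form x y = tofrac (stform x y).
Proof. by rewrite /stform; case: cid. Qed.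

Lemma stform_ga x y :
  ga_form (lattice_elt x) (lattice_elt y) = #|borel F n|%:R * stform x y.
Proof.
apply/eqP; rewrite -tofrac_eq tofracM -stformE /steinberg_form tofracMn tofrac1.
rewrite mulrC divfK //.
by rewrite -tofrac1 -tofracMn tofrac_eq0 borel_neq0.
Qed.

Lemma stformC x y : stform x y = stform y x.
Proof. by apply: (mulfI borel_neq0); rewrite -!stform_ga ga_formC. Qed.

Lemma stformDl x x' y : stform (x + x') y = stform x y + stform x' y.
Proof. by apply: (mulfI borel_neq0); rewrite mulrDr -!stform_ga ga_formDl. Qed.

Lemma stformZl (k : R) x y : stform (k%:A *: x) y = k * stform x y.
Proof.
apply: (mulfI borel_neq0); rewrite mulrCA -!stform_ga lattice_eltZ -ga_formZl.
by rewrite -scalerAl mul1r.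
Qed.

Lemma stformMl (a : RG) x y : stform (a *: x) y = stform x (ga_inv a *: y).
Proof. by apply: (mulfI borel_neq0); rewrite -!stform_ga !lattice_eltZ ga_formM. Qed.

Lemma stformDr x y y' : stform x (y + y') = stform x y + stform x y'.
Proof. by rewrite stformC stformDl ![stform _ x]stformC. Qed.

Lemma stformZr (k : R) x y : stform x (k%:A *: y) = k * stform x y.
Proof. by rewrite stformC stformZl stformC. Qed.

Lemma stform0l y : stform 0 y = 0.
Proof. by rewrite -(scale0r (0 : I)) -(scale0r (1 : RG)) stformZl mul0r. Qed.

Lemma stform_suml (J : Type) (s : seq J) (P : pred J) (f : J -> I) y :
  stform (\sum_(j <- s | P j) f j) y = \sum_(j <- s | P j) stform (f j) y.
Proof.
elim/big_rec2: _ => [|i z w _ <-]; first exact: stform0l.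
by rewrite stformDl.
Qed.

Lemma stform_sumr (J : Type) (s : seq J) (P : pred J) (f : J -> I) x :
  stform x (\sum_(j <- s | P j) f j) = \sum_(j <- s | P j) stform x (f j).
Proof. by rewrite stformC stform_suml; apply: eq_bigr => j _; rewrite stformC. Qed.

Definition steinberg_dual : I := ga_hat R U *: steinberg_gen.

(** The index arises as the order of the group divided by that of the Borel
subgroup, the latter being the normalization of the form. *)
Lemma stform_dual x g :
  stform x (ga_elt R g *: steinberg_dual) = #|[set: G] : borel F n|%g%:R * lattice_elt x g.
Proof.
apply: (mulfI borel_neq0); rewrite -stform_ga mulrA -natrM.
rewrite (Lagrange (subsetT (borel_group F n))) cardsT.
have [a xE] := lattice_eltP x; rewrite xE; apply: bn_form_dual.
  exact/mulfI/(card_neq0 (bnT D)).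
exact/mulIf/(card_neq0 U).
Qed.

Variable (l : nat).

Lemma jantzenP c x :
  x \in jantzen F n R l c <-> forall y, exists k, stform x y = l%:R ^+ c * k.
Proof.
split=> [/asboolP H y|H]; last apply/asboolP => y.
  have [k kE] := H y; exists k; apply/eqP.
  by rewrite -tofrac_eq -stformE kE.
by have [k kE] := H y; exists k; rewrite stformE kE.
Qed.

Lemma l_latticeP x : x \in l_lattice F n R l <-> exists y, x = l%:R%:A *: y.
Proof.
have E y : l%:R%:A *: y = y *+ l.
  by rewrite !scaler_nat.
by split=> [/asboolP[y ->]|[y ->]]; [exists y | apply/asboolP; exists y].
Qed.

End Lattice.

(** * The Jantzen layers *)

Section Main.
Local Open Scope quotient_scope.
Variables (F : finFieldType) (n l : nat) (R : idomainType) (m : idealr R).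
Hypotheses (hl : prime l) (hchar : [pchar R] =i pred0).
Hypotheses (hpid : principal_ideal_ring R) (hlocal : local_with m).
Hypothesis (hm : generated_by m l%:R).
Local Notation G := (matrix_GLtype__canonical__fingroup_FinGroup n F).
Local Notation RG := (grpalg R G).
Local Notation K := {ideal_quot m}.
Local Notation KG := (grpalg K G).
Local Notation I := (steinberg_lattice F n R).
Local Notation L := (steinberg_mod F n hm).
Local Notation J := (jantzen F n R l).
Local Notation lI := (l_lattice F n R l).
Local Notation r := #|bnU (GL_bn F n)|.
Local Notation e := (@steinberg_basis F n R).
Local Notation f := (@stform F n R).
Local Notation hlayer c := (@jantzen_layer_subproof F n R l m hm c).
Implicit Types x y : I.

Let l_neq0 : l%:R != 0 :> R.
Proof. exact: natr_neq0 hchar _ (prime_gt0 hl). Qed.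

Let lX_neq0 c : l%:R ^+ c != 0 :> R.
Proof. exact: expf_neq0. Qed.

(** By a Bezout relation, [k] cannot belong to the maximal ideal together with
[l]. *)
Lemma coprime_unit k : coprime l k -> (k%:R : R) \is a GRing.unit.
Proof.
move=> co; have [//|km] := unit_or_max hpid hlocal (k%:R : R).
have lm : l%:R \in m by apply/hm; exists 1; rewrite mulr1.
have [u v uv _] := egcdnP k (prime_gt0 hl).
have : u%:R * l%:R - v%:R * k%:R \in m by rewrite rpredB ?idealMr.
by rewrite -!natrM uv (eqP co) addnC natrD addrK idealr1.
Qed.

(** Pairing [x] with the translates of the dual vector shows that [[G : B] x(g)]
is divisible by [l^(c+1)] for all [g]; the index has valuation at most [c]. *)
Lemma jantzen_sub_l_lattice c x :
  (logn l #|[set: G] : borel F n|%g <= c)%N -> x \in J c.+1 -> x \in lI.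
Proof.
set idx := #|_ : _|%g => bc /jantzenP xJ; apply/l_latticeP/lattice_divide => g.
have idx_gt0 : (0 < idx)%N by apply: (indexg_gt0 _ (borel_group F n)).
have [k kE] := xJ (ga_elt R g *: steinberg_dual F n R).
rewrite (stform_dual hchar) -/idx in kE.
have [q co idxE] := pfactor_coprime hl idx_gt0.
have qU := coprime_unit co.
exists (q%:R^-1 * (l%:R ^+ (c - logn l idx) * k)).
apply: (mulfI (natr_neq0 hchar idx_gt0)); rewrite kE {1}idxE natrM natrX.
rewrite [l%:R * (_ * _)]mulrCA mulrACA mulrV // mul1r !mulrA -exprSr -exprD.
by rewrite addSn subnKC.
Qed.

Lemma lI_sub_jantzen1 x : x \in lI -> x \in J 1.
Proof.
move=> /l_latticeP[y ->]; apply/jantzenP => z.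
by exists (f y z); rewrite stformZl // expr1.
Qed.

Lemma jantzenS c : {subset J c.+1 <= J c}.
Proof.
move=> x /jantzenP H; apply/jantzenP => y; have [k ->] := H y.
by exists (l%:R * k); rewrite exprSr mulrA.
Qed.

Lemma jantzen_mul c x : (l%:R%:A *: x \in J c.+1) = (x \in J c).
Proof.
apply/idP/idP => /jantzenP H; apply/jantzenP => y; have [k E] := H y; exists k.
  by apply: (mulfI l_neq0); rewrite -stformZl // E exprS mulrA.
by rewrite stformZl // E exprS mulrA.
Qed.

Local Notation red := (@ga_red R m G).

Definition projL (x : I) : L := quo_pi lI x.

Lemma projLP (a : RG) x y : projL (a *: x + y) = red a *: projL x + projL y.
Proof.
rewrite /projL linearP; congr (_ + _); apply: esym.
exact: (res_scale_lift (steinberg_mod_subproof hm)).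
Qed.

Lemma projL_eq0 x : (projL x == 0) = (x \in lI).
Proof. exact: quo_pi_eq0. Qed.

Lemma projL_surj (u : L) : exists x, projL x = u.
Proof. exact: quo_pi_surj. Qed.

Lemma projLB x y : projL (x - y) = projL x - projL y.
Proof. by rewrite /projL linearB. Qed.

Lemma projLN x : projL (- x) = - projL x.
Proof. by rewrite /projL linearN. Qed.

Lemma projL_jantzen c x :
  (projL x \in jantzen_mod F n hm c) <-> exists2 y, y \in J c & x - y \in lI.
Proof.
split=> [/asboolP[z /asboolP[y yJ [w wl ->]] E]|[y yJ xyl]].
  exists y => //; rewrite -(subrK w (x - y)) rpredD //.
  by rewrite -addrA -opprD -projL_eq0 projLB E subrr.
apply/asboolP; exists x => //; apply/asboolP; exists y => //.
by exists (x - y); rewrite // addrC subrK.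
Qed.

Lemma jantzen_proj c (x : submod_of (J c)) : projL (val x) \in jantzen_mod F n hm c.
Proof. by apply/projL_jantzen; exists (val x); rewrite ?subrr ?rpred0 // (valP x). Qed.

(** The surjection from [I(c)] to [L(c)/L(c+1)] induced by reduction modulo [l]. *)
Definition layer_map c (x : submod_of (J c)) :
    subquo (jantzen_mod F n hm c) (jantzen_mod F n hm c.+1) :=
  quo_pi _ (Submod (jantzen_proj x)).

Lemma layer_map_linear c (a : RG) (x y : submod_of (J c)) :
  layer_map (a *: x + y) = red a *: layer_map x + layer_map y.
Proof.
rewrite /layer_map; set u := Submod _; set v := Submod _; set w := Submod _.
have -> : u = red a *: v + w by apply: val_inj; exact: (projLP a (val x) (val y)).
exact: linearP.
Qed.

Lemma layer_map_surj c u : exists x : submod_of (J c), layer_map x = u.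
Proof.
have [[w wP] <-] := quo_pi_surj u; have [x xw] := projL_surj w.
have /projL_jantzen[y yJ xyl] : projL x \in jantzen_mod F n hm c by rewrite xw.
exists (Submod yJ); rewrite /layer_map; congr quo_pi; apply: val_inj => /=.
by apply/eqP; rewrite -xw eq_sym -subr_eq0 -projLB projL_eq0.
Qed.

Lemma layer_map_eq0 c (x : submod_of (J c)) :
  layer_map x = 0 <-> exists2 y, y \in J c.+1 & val x - y \in lI.
Proof.
by rewrite -projL_jantzen; split=> [/eqP|H]; [|apply/eqP]; rewrite quo_pi_eq0.
Qed.

Lemma jantzen_layer0_iso : lmod_iso (jantzen_layer F n hm 0)
   (subquo (jantzen_mod F n hm 0) (jantzen_mod F n hm 1)).
Proof.
apply: (@residue_iso _ _ _ _ _ (hlayer 0) _ (@layer_map 0)) => [a x y|u|x].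

- exact: layer_map_linear.
- exact: layer_map_surj.
apply/eqP/idP => [/layer_map_eq0[y yJ xyl]|xJ].
  by rewrite inE -(subrK y (val x)) rpredD // lI_sub_jantzen1.
by apply/layer_map_eq0; exists (val x); rewrite ?subrr ?rpred0.
Qed.

Lemma jantzen_mul_mem c (x : submod_of (J c)) : l%:R%:A *: val x \in J c.+1.
Proof. by rewrite jantzen_mul (valP x). Qed.

(** Multiplication by [l] from [I(c)] to [I(c+1)/I(c+2)]. *)
Definition mul_map c (x : submod_of (J c)) : jantzen_layer F n hm c.+1 :=
  quo_pi _ (Submod (jantzen_mul_mem x)).

Lemma mul_map_linear c (a : RG) (x y : submod_of (J c)) :
  mul_map (a *: x + y) = red a *: mul_map x + mul_map y.
Proof.
rewrite /mul_map; set u := Submod _; set v := Submod _; set w := Submod _.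
have -> : u = a *: v + w.
  have key (x' y' : I) :
      l%:R%:A *: (a *: x' + y') = a *: (l%:R%:A *: x') + l%:R%:A *: y'.
    by rewrite scalerDr !scalerA mulr_algl mulr_algr.
  by apply: val_inj; exact: (key (val x) (val y)).
apply: (etrans (linearP _ _ _ _)); congr (_ + _); apply: esym.
exact: (res_scale_lift (hlayer c.+1)).
Qed.

(** The kernel of the surjection from [I(c+1)/I(c+2)] to [L(c+1)/L(c+2)] comes
from the elements [y + l z] with [y] in [I(c+2)]; then [l z] is in [I(c+1)],
that is, [z] is in [I(c)]. *)
Lemma composition_factors_layerS c fs gs :
  composition_factors (jantzen_layer F n hm c) fs ->
  composition_factors (subquo (jantzen_mod F n hm c.+1) (jantzen_mod F n hm c.+2)) gs ->
  composition_factors (jantzen_layer F n hm c.+1) (fs ++ gs).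
Proof.
have [|i iE] := @residue_lift _ _ _ _ _ (hlayer c) _ _ (@mul_map_linear c).
  by move=> x xS; apply/eqP; rewrite quo_pi_eq0 inE /= jantzen_mul.
have [|p pE] := @residue_lift _ _ _ _ _ (hlayer c.+1) _ _ (@layer_map_linear c.+1).
  by move=> x xS; apply/layer_map_eq0; exists (val x); rewrite ?subrr ?rpred0.
apply: (composition_factors_ext (i := i) (p := p)) => [u v|u|u].
- have [x <-] := quo_pi_surj u; have [y <-] := quo_pi_surj v; rewrite !iE => /eqP.
  rewrite quo_piE inE /= -scalerBr jantzen_mul => xy.
  by apply/eqP; rewrite quo_piE.
- by have [x <-] := layer_map_surj u; exists (quo_pi _ x); rewrite pE.
have [x <-] := quo_pi_surj u; rewrite pE layer_map_eq0.
split=> [[y yJ /l_latticeP[z xyE]]|[v]].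
  have zJ : z \in J c.
    rewrite -jantzen_mul -xyE rpredB //; last exact: jantzenS.
    exact: (valP x).
  exists (quo_pi _ (Submod zJ)); rewrite iE; apply/eqP; rewrite quo_piE inE /=.
  by rewrite -xyE opprB addrC subrK.
have [z <-] := quo_pi_surj v; rewrite iE => /eqP; rewrite quo_piE inE /= => xz.
exists (val x - l%:R%:A *: val z) => //; rewrite opprB addrC subrK.
by apply/l_latticeP; exists (val z).
Qed.

Lemma composition_factors_layer c (fs : nat -> seq (lmodType KG)) :
  (forall i, (i <= c)%N -> composition_factors
     (subquo (jantzen_mod F n hm i) (jantzen_mod F n hm i.+1)) (fs i)) ->
  composition_factors (jantzen_layer F n hm c) (flatten [seq fs i | i <- iota 0 c.+1]).
Proof.
elim: c => [|c IH] fsP.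
  rewrite /= cats0; apply: composition_factors_iso jantzen_layer0_iso _; exact: fsP.
rewrite -[c.+2]addn1 iotaD map_cat flatten_cat /= cats0 add0n.
by apply: composition_factors_layerS; [apply: IH => i ic; apply: fsP; apply: leqW | apply: fsP].
Qed.

(** The flag is spanned by the first basis vectors; a leading coefficient that
is not a unit of [R] acts as zero on [L]. *)
Lemma steinberg_finite_length : finite_length L.
Proof.
pose v (i : nat) : L := if insub i is Some j then projL (e j) else 0.
pose V (k : nat) (u : L) := exists a : 'I_r -> R,
  u = projL (\sum_(i < r | (i < k)%N) (a i)%:A *: e i).
apply: (@finite_length_flag _ L r v V) => [u [a ->]|u|k u w [a ->] [b ->]|k u kr [a ->]].
- by rewrite big_pred0 // /projL linear0.
- have [x <-] := projL_surj u; exists (steinberg_coord x); rewrite {1}(steinberg_expand x).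
  by congr projL; apply: eq_bigl => i; rewrite ltn_ord.
- exists (fun i => a i - b i); rewrite -projLB -sumrB; congr projL.
  by apply: eq_bigr => i _; rewrite -scalerBl -scalerBl.
rewrite (bigD1 (Ordinal kr)) //=; set x := \sum_(i | _) _.
have xE : x = \sum_(i < r | (i < k)%N) (a i)%:A *: e i.
  by apply: eq_bigl => i; rewrite ltnS -val_eqE /= ltn_neqAle andbC.
have vE : v k = projL (e (Ordinal kr)) by rewrite /v insubT.
have [aU|/hm[b aE]] := unit_or_max hpid hlocal (a (Ordinal kr)); [right | left].
  exists (red (a (Ordinal kr))^-1%:A), (red (a (Ordinal kr))%:A); split.
    by rewrite -ga_redM -scalerAl mul1r scalerA mulrV // scale1r ga_red1.
  exists (fun i => (a (Ordinal kr))^-1 * a i).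
  have -> : red (a (Ordinal kr))^-1%:A *:
      projL ((a (Ordinal kr))%:A *: e (Ordinal kr) + x) - v k =
      projL ((a (Ordinal kr))^-1%:A *: x).
    have := projLP (a (Ordinal kr))^-1%:A ((a (Ordinal kr))%:A *: e (Ordinal kr) + x)
              (- e (Ordinal kr)).
    rewrite vE projLN => <-; congr projL.
    by rewrite scalerDr scale_algA mulVr // !scale1r addrAC subrr add0r.
  congr projL; rewrite xE scaler_sumr; apply: eq_bigr => i _.
  by rewrite scale_algA.
exists a; rewrite -xE; apply/eqP; rewrite -subr_eq0 -projLB addrK projL_eq0.
by apply/l_latticeP; exists (b%:A *: e (Ordinal kr)); rewrite scale_algA aE.
Qed.

Lemma residue_eq0 (k : R) : (\pi_K k == 0 :> K) = (k \in m).
Proof. by rewrite -(rmorph0 \pi_K) -Quotient.idealrBE subr0. Qed.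

Lemma jantzen_value c (x : submod_of (J c)) y : exists k, f (val x) y = l%:R ^+ c * k.
Proof. by have /jantzenP := valP x; apply. Qed.

(** The divided form [l^-c f(x, y)]. *)
Definition layer_form c (x : submod_of (J c)) y : R := sval (cid (jantzen_value x y)).

Lemma layer_formE c (x : submod_of (J c)) y : f (val x) y = l%:R ^+ c * layer_form x y.
Proof. by rewrite /layer_form; case: cid. Qed.

Lemma layer_formP c (a : RG) (x x' : submod_of (J c)) y :
  layer_form (a *: x + x') y = layer_form x (ga_inv a *: y) + layer_form x' y.
Proof.
apply: (mulfI (lX_neq0 c)); rewrite mulrDr -!layer_formE -stformMl //.
by rewrite -stformDl.
Qed.

Lemma layer_formDr c (x : submod_of (J c)) (k : R) y y' :
  layer_form x (k%:A *: y + y') = k * layer_form x y + layer_form x y'.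
Proof.
apply: (mulfI (lX_neq0 c)); rewrite mulrDr mulrCA -!layer_formE.
by rewrite stformDr // stformZr.
Qed.

Local Notation Q c := (quo_mod (jantzen_mod F n hm c)).

Definition projQ c y : Q c := quo_pi _ (projL y).

Lemma projQP c (a : RG) y y' : projQ c (a *: y + y') = red a *: projQ c y + projQ c y'.
Proof. by rewrite /projQ projLP; apply: linearP. Qed.

Lemma projQ0 c : projQ c 0 = 0.
Proof. by rewrite -(subrr (0 : I)) /projQ projLB subrr; apply: linear0. Qed.

Lemma projQB c y y' : projQ c (y - y') = projQ c y - projQ c y'.
Proof. by rewrite /projQ projLB; apply: linearB. Qed.

Lemma projQ_surj c (u : Q c) : exists y, projQ c y = u.
Proof.
have [w <-] := quo_pi_surj u; have [y <-] := projL_surj w.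
by exists y.
Qed.

Lemma projQ_eq0 c y : projQ c y = 0 <-> exists2 z, z \in J c & y - z \in lI.
Proof.
rewrite -projL_jantzen; split=> [/eqP|H]; [|apply/eqP]; by rewrite quo_pi_eq0.
Qed.

(** By symmetry of the form, an element of [I(c)] pairs with [I(c+1)] in
[l^(c+1) R]. *)
Lemma layer_form_mod c (x : submod_of (J c)) y : projQ c.+1 y = 0 -> layer_form x y \in m.
Proof.
move=> /projQ_eq0[z /jantzenP/(_ (val x))[k kE] /l_latticeP[w yzE]].
apply/hm; exists (k + layer_form x w); apply: (mulfI (lX_neq0 c)).
rewrite -layer_formE -(subrK z y) stformDr // yzE stformZr // layer_formE.
rewrite stformC // kE mulrDr [_ * (l%:R * _ + _)]mulrDr exprSr addrC -!mulrA.
by rewrite [l%:R * (_ * _)]mulrCA.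
Qed.

Lemma layer_form_wd c (x : submod_of (J c)) y y' : projQ c.+1 y = projQ c.+1 y' ->
  \pi_K (layer_form x y) = \pi_K (layer_form x y') :> K.
Proof.
move=> yy'; apply/eqP; rewrite -Quotient.idealrBE.
have <- : layer_form x (y - y') = layer_form x y - layer_form x y'.
  have := layer_formDr x (-1) y' y.
  by rewrite scaleN1r scaleN1r mulN1r ![- _ + _]addrC.
by apply: layer_form_mod; rewrite projQB yy' subrr.
Qed.

Lemma linear_form_projQ c (u : dual_mod (Q c)) (k : R) y y' :
  val u (projQ c (k%:A *: y + y')) = \pi_K k * val u (projQ c y) + val u (projQ c y').
Proof.
have redk : red k%:A = (\pi_K k)%:A :> KG.
  apply/ffunP => g; rewrite !ffunE (rmorphM \pi_K); congr (_ * _).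
  by rewrite (rmorph_nat \pi_K).
by rewrite projQP redk dual_fun_linear.
Qed.

(** Reducing the divided form modulo [l] defines a functional on [L / L(c+1)]. *)
Lemma functional_exists c (x : submod_of (J c)) :
  exists u : dual_mod (Q c.+1), forall y, val u (projQ c.+1 y) = \pi_K (layer_form x y).
Proof.
have [g gK] := choice (@projQ_surj c.+1).
pose u z := \pi_K (layer_form x (g z)) : K.
have uE y : u (projQ c.+1 y) = \pi_K (layer_form x y).
  by apply: layer_form_wd; rewrite gK.
have ul : u \in @linear_form_pred K G (Q c.+1).
  apply/asboolP => k z z'; have [y <-] := projQ_surj z; have [y' <-] := projQ_surj z'.
  rewrite -[k]reprK.
  have redk : red (repr k)%:A = (\pi_K (repr k))%:A :> KG.
    apply/ffunP => h; rewrite !ffunE (rmorphM \pi_K); congr (_ * _).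
    by rewrite (rmorph_nat \pi_K).
  by rewrite -redk -projQP !uE layer_formDr (rmorphD \pi_K) (rmorphM \pi_K).
by exists (DualMod ul).
Qed.

Definition layer_dual c (x : submod_of (J c)) : dual_mod (Q c.+1) :=
  sval (cid (functional_exists x)).

Lemma layer_dualE c (x : submod_of (J c)) y :
  val (layer_dual x) (projQ c.+1 y) = \pi_K (layer_form x y).
Proof. by rewrite /layer_dual; case: cid => u uE; exact: uE. Qed.

Lemma dual_ext c (u v : dual_mod (Q c)) :
  (forall y, val u (projQ c y) = val v (projQ c y)) -> u = v.
Proof.
by move=> uv; apply/val_inj/funext => z; have [y <-] := projQ_surj z; exact: uv.
Qed.

Lemma red_inv (a : RG) : ga_inv (red a) = red (ga_inv a).
Proof. by apply/ffunP => g; rewrite !ffunE. Qed.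

Lemma layer_dual_linear c (a : RG) (x y : submod_of (J c)) :
  layer_dual (a *: x + y) = red a *: layer_dual x + layer_dual y.
Proof.
apply: dual_ext => z; rewrite layer_dualE layer_formP (rmorphD \pi_K).
rewrite [RHS]dual_funD [X in _ = X + _]dual_funZ.
rewrite layer_dualE red_inv; congr (_ + _).
have -> : red (ga_inv a) *: projQ c.+1 z = projQ c.+1 (ga_inv a *: z).
  have := projQP c.+1 (ga_inv a) z 0; rewrite addr0 => ->.
  by rewrite projQ0 addr0.
by rewrite layer_dualE.
Qed.

Lemma layer_dual_eq0 c (x : submod_of (J c)) :
  (layer_dual x == 0) = (val x \in J c.+1).
Proof.
apply/eqP/idP => [x0|/jantzenP xJ].
  apply/jantzenP => y; have := layer_dualE x y; rewrite x0.
  rewrite dual_fun0.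
  move=> /esym/eqP; rewrite residue_eq0 => /hm[k kE].
  by exists k; rewrite layer_formE kE exprSr mulrA.
apply: dual_ext => y; rewrite layer_dualE; have [k kE] := xJ y.
rewrite dual_fun0.
apply/eqP; rewrite residue_eq0; apply/hm; exists k.
by apply: (mulfI (lX_neq0 c)); rewrite -layer_formE kE exprSr mulrA.
Qed.

Lemma linear_form_projQ_sum c (u : dual_mod (Q c)) (a : 'I_r -> R) :
  val u (projQ c (\sum_i (a i)%:A *: e i)) = \sum_i \pi_K (a i) * val u (projQ c (e i)).
Proof.
have u0 : val u (projQ c 0) = 0 by rewrite projQ0 dual_fun_at0.
elim/big_ind2: _ => // [x x' y y' <- <-|i _].
  have := linear_form_projQ u 1 x' y'.
  by rewrite scale1r scale1r (rmorph1 \pi_K) mul1r.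
have := linear_form_projQ u (a i) (e i) 0.
by rewrite addr0 u0 addr0.
Qed.

(** The functional is lifted to a row vector [phi] of values on the basis of [I];
its vanishing on [L(c+1)] is the hypothesis of [dual_image] for the Gram matrix,
and the solution [x] of the congruence is the sought element of [I(c)]. *)
Lemma layer_dual_surj c (u : dual_mod (Q c.+1)) : exists x : submod_of (J c), layer_dual x = u.
Proof.
pose phi : 'rV[R]_r := \row_i repr (val u (projQ c.+1 (e i))).
have phiE i : \pi_K (phi 0 i) = val u (projQ c.+1 (e i)) by rewrite mxE reprK.
pose A := \matrix_(i, j) f (e i) (e j).
have [y [z yzE]|a [b abE]] := @dual_image _ m _ hpid hlocal hm _ A c phi.
  set Y := \sum_i (y i 0)%:A *: e i.
  have YJ : Y \in J c.+1.
    apply/jantzenP => x; exists (\sum_i steinberg_coord x i * z i 0).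
    rewrite stformC // {1}(steinberg_expand x) stform_suml // mulr_sumr.
    apply: eq_bigr => i _; rewrite stformZl // mulrCA; congr (_ * _).
    move/matrixP/(_ i 0): yzE; rewrite !mxE => <-; rewrite stform_sumr //.
    by apply: eq_bigr => j _; rewrite stformZr // mxE mulrC.
  have Y0 : projQ c.+1 Y = 0.
    by apply/projQ_eq0; exists Y; rewrite ?subrr ?rpred0.
  rewrite -residue_eq0 mxE (raddf_sum \pi_K).
  have := linear_form_projQ_sum u (fun i => y i 0); rewrite -/Y Y0.
  rewrite dual_fun_at0 => sum0; apply/eqP; rewrite [RHS]sum0.
  apply: eq_bigr => i _; rewrite mulrC; apply: (etrans (rmorphM \pi_K _ _)).
  by congr (_ * _); apply: phiE.
pose X := \sum_i (a 0 i)%:A *: e i.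
have XE j : f X (e j) = l%:R ^+ c * (phi 0 j + l%:R * b 0 j).
  move/matrixP/(_ 0 j): abE; rewrite !mxE mulrDr mulrA -exprSr => <-.
  rewrite stform_suml //; apply: eq_bigr => i _; by rewrite stformZl // mxE.
have XJ : X \in J c.
  apply/jantzenP => y; rewrite (steinberg_expand y) stform_sumr //.
  exists (\sum_j steinberg_coord y j * (phi 0 j + l%:R * b 0 j)).
  rewrite mulr_sumr; apply: eq_bigr => j _; by rewrite stformZr // XE mulrCA.
exists (Submod XJ); apply: dual_ext => y; rewrite (steinberg_expand y).
rewrite !linear_form_projQ_sum; apply: eq_bigr => j _; congr (_ * _).
rewrite layer_dualE -phiE; apply/eqP; rewrite -Quotient.idealrBE; apply/hm.
exists (b 0 j); apply: (mulfI (lX_neq0 c)); rewrite mulrBr -layer_formE XE.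
by rewrite mulrDr addrC addKr.
Qed.

Lemma jantzen_layer_iso_dual c : lmod_iso (jantzen_layer F n hm c)
   (dual_mod (quo_mod (jantzen_mod F n hm c.+1))).
Proof.
apply: (@residue_iso _ _ _ _ _ (hlayer c) _ (@layer_dual c)) => [a x y|u|x].
- exact: layer_dual_linear.
- exact: layer_dual_surj.
exact: layer_dual_eq0.
Qed.

Lemma jantzen_layer_iso_dual_high c : (logn l #|[set: G] : borel F n|%g <= c)%N ->
  lmod_iso (jantzen_layer F n hm c) (dual_mod L).
Proof.
move=> bc; apply: lmod_iso_trans (jantzen_layer_iso_dual c) _.
have L0 (u : L) : u \in jantzen_mod F n hm c.+1 -> u = 0.
  have [x <-] := projL_surj u => /projL_jantzen[y yJ xyl].
  apply/eqP; rewrite projL_eq0 -(subrK y x) rpredD //.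
  exact: jantzen_sub_l_lattice yJ.
apply: dual_iso.
have [f fE] := @linear_packed _ L (Q c.+1) (@quo_pi _ _ _) (fun a u v => linearP _ a u v).
exists f; apply: inj_surj_bijective => [u v|w].
  by rewrite !fE => /eqP; rewrite quo_piE => /L0/eqP; rewrite subr_eq0 => /eqP.
by have [u <-] := quo_pi_surj w; exists u; rewrite fE.
Qed.

Lemma composition_factors_jantzen_mod c : exists fs, composition_factors
   (subquo (jantzen_mod F n hm c) (jantzen_mod F n hm c.+1)) fs.
Proof.
apply: composition_factors_exist; apply: finite_length_subquo.
exact: steinberg_finite_length.
Qed.
End Main.

Unset Implicit Arguments.
Set Strict Implicit.

Theorem theorem7p1 (n : nat) (F : finFieldType) (p l : nat)
    (R : idomainType) (m : idealr R)
    (hn : (2 <= n)%N)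
    (hp : p \in [pchar F])
    (hl : prime l) (hlp : l <> p)
    (hchar : [pchar R] =i pred0)
    (hpid : principal_ideal_ring R)
    (hlocal : local_with m)
    (hm : generated_by m l%:R)
    (hroot : exists z : R, p.-primitive_root z) :
  [/\ (* (a) *)
      forall c : nat,
        lmod_iso (jantzen_layer F n hm c)
                 (dual_mod (quo_mod (jantzen_mod F n hm c.+1))),
      (* (b) *)
      forall c : nat,
        (forall i : nat, (i <= c)%N ->
           exists fs, composition_factors
             (subquo (jantzen_mod F n hm i) (jantzen_mod F n hm i.+1)) fs) /\
        forall fs : nat -> seq (lmodType (grpalg {ideal_quot m} {'GL_n[F]})),
          (forall i : nat, (i <= c)%N ->
             composition_factors
               (subquo (jantzen_mod F n hm i) (jantzen_mod F n hm i.+1))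
               (fs i)) ->
          composition_factors (jantzen_layer F n hm c)
            (flatten [seq fs i | i <- iota 0 c.+1]),
      (* (c) *)
      lmod_iso (jantzen_layer F n hm 0)
               (subquo (jantzen_mod F n hm 0) (jantzen_mod F n hm 1)) &
      (* (d) *)
      forall c : nat,
        (logn l #|[set: {'GL_n[F]}] : borel F n|%g <= c)%N ->
        lmod_iso (jantzen_layer F n hm c) (dual_mod (steinberg_mod F n hm))].
Proof.
split.
- exact: (jantzen_layer_iso_dual F n hl hchar hpid hlocal hm).
- move=> c; split=> [i _|fs].
    exact: composition_factors_jantzen_mod.
  exact: composition_factors_layer.
- exact: jantzen_layer0_iso.
- exact: (jantzen_layer_iso_dual_high hl hchar hpid hlocal hm).
Qed.
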